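(* Let $F$ be a rigid field and let $\varphi$ be an anisotropic quadratic form over $F$ of dimension $14$ whose Witt class lies in $I^3F$. Then there exist $\pi_1,\pi_2\in GP_3F$ such that $\varphi=\pi_1+\pi_2$ in the Witt ring $WF$.
   Context: All fields have characteristic different from $2$; quadratic form means finite-dimensional non-degenerate quadratic form. $WF$ is the Witt ring, $IF$ its fundamental ideal, $I^3F=(IF)^3$; a form and its Witt class are denoted by the same symbol. For $a_1,\dots,a_n\in F^\ast$, the $n$-fold Pfister form is $\langle\langle a_1,\ldots,a_n\rangle\rangle:=\langle 1,-a_1\rangle\otimes\cdots\otimes\langle 1,-a_n\rangle$, and $GP_nF$ denotes the set of forms similar to some $n$-fold Pfister form. A field $F$ is rigid if every binary anisotropic quadratic form over $F$ represents at most $2$ square classes of $F^\ast/F^{\ast 2}$. *)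

(* Defs.v *)
From mathcomp Require Import all_boot all_order all_algebra.
From mathcomp.real_closed Require Import mxtens.

Set Implicit Arguments.
Unset Strict Implicit.
Unset Printing Implicit Defensive.

Import GRing.Theory.
Local Open Scope ring_scope.

(* A non-degenerate quadratic form on F^n, char F != 2, is given by its Gram
   matrix A: it is v |-> v A v^T on row vectors. *)
Record qform (F : fieldType) := QForm {
  qdim : nat;
  gram : 'M[F]_qdim;
  gram_sym : gram^T = gram;
  gram_unit : gram \in unitmx
}.

Section Forms.
Variable F : fieldType.
Implicit Types (q p : qform F).

Definition qval q (v : 'rV[F]_(qdim q)) : F := (v *m gram q *m v^T) 0 0.

Definition anisotropic q := forall v : 'rV[F]_(qdim q), qval v = 0 -> v = 0.

Definition represents q (c : F) :=
  c != 0 /\ exists v : 'rV[F]_(qdim q), qval v = c.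

Definition isometric q p :=
  exists f : {linear 'rV[F]_(qdim q) -> 'rV[F]_(qdim p)},
    bijective f /\ forall v, qval (f v) = qval v.

Fact qzero_sym : (0 : 'M[F]_0)^T = 0.
Proof. exact: trmx0. Qed.

Fact qzero_unit : (0 : 'M[F]_0) \in unitmx.
Proof. by rewrite unitmxE det_mx00 unitr1. Qed.

Definition qzero : qform F := QForm qzero_sym qzero_unit.

Fact qunary_unit (a : F) : a != 0 -> (a%:M : 'M[F]_1) \in unitmx.
Proof. by move=> a0; rewrite unitmxE det_scalar1 unitfE. Qed.

(* The one-dimensional form <a>. *)
Definition qunary (a : F) (a0 : a != 0) : qform F :=
  QForm (tr_scalar_mx 1 a) (qunary_unit a0).

Fact qscale_sym (c : F) q : (c *: gram q)^T = c *: gram q.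
Proof. by rewrite linearZ /= gram_sym. Qed.

Fact qscale_unit (c : F) q : c != 0 -> c *: gram q \in unitmx.
Proof. by move=> c0; rewrite unitmxZ ?unitfE // gram_unit. Qed.

Definition qscale (c : F) (c0 : c != 0) q : qform F :=
  QForm (qscale_sym c q) (qscale_unit q c0).

Definition similar q p := exists (c : F) (c0 : c != 0), isometric q (qscale c0 p).

Fact qsum_sym q p :
  (block_mx (gram q) 0 0 (gram p))^T = block_mx (gram q) 0 0 (gram p).
Proof. by rewrite tr_block_mx !trmx0 !gram_sym. Qed.

Fact qsum_unit q p : block_mx (gram q) 0 0 (gram p) \in unitmx.
Proof.
by rewrite unitmxE det_ublock unitrM -!unitmxE !gram_unit.
Qed.

(* Orthogonal sum. *)
Definition qsum q p : qform F := QForm (qsum_sym q p) (qsum_unit q p).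

Fact qtensor_sym q p : (gram q *t gram p)^T = gram q *t gram p.
Proof. by rewrite trmx_tens !gram_sym. Qed.

Fact qtensor_unit q p : gram q *t gram p \in unitmx.
Proof.
case: q p => [m A sA uA] [n B sB uB] /=.
case: m A sA uA => [|m] A _ uA; first by rewrite unitmxE det_mx00 unitr1.
case: n B sB uB => [|n] B _ uB; last exact: tensmx_unit.
by rewrite unitmxE; move: (A *t B); rewrite muln0 => C; rewrite det_mx00 unitr1.
Qed.

Definition qtensor q p : qform F := QForm (qtensor_sym q p) (qtensor_unit q p).

Definition qone : qform F := qunary (oner_neq0 F).

Fact qopp_neq0 (a : F) : a != 0 -> - a != 0.
Proof. by rewrite oppr_eq0. Qed.

(* <<a>> = <1, -a> *)
Definition pfister1 (a : {a : F | a != 0}) : qform F :=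
  qsum qone (qunary (qopp_neq0 (svalP a))).

Definition pfister (s : seq {a : F | a != 0}) : qform F :=
  \big[qtensor/qone]_(a <- s) pfister1 a.

(* The set GP_n F. *)
Definition GP (n : nat) q :=
  exists s : n.-tuple {a : F | a != 0}, similar q (pfister s).

(* The hyperbolic plane <1, -1>; in characteristic != 2 this is the form XY. *)
Definition hyperbolic_plane : qform F :=
  qsum qone (qunary (qopp_neq0 (oner_neq0 F))).

Definition hyperbolic (m : nat) : qform F :=
  \big[qsum/qzero]_(i < m) hyperbolic_plane.

(* Equality of Witt classes.  The Witt ring WF is the quotient of [qform F] by
   this relation, with the operations induced by [qsum] and [qtensor]; an
   additive subgroup of WF is handled as a predicate on representatives. *)
Definition witt_eq q p :=
  exists m n : nat, isometric (qsum q (hyperbolic m)) (qsum p (hyperbolic n)).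

(* IF: the parity of the dimension only depends on the Witt class. *)
Definition fund_ideal q : Prop := ~~ odd (qdim q).

(* The product of two ideals of WF: finite sums of products. *)
Definition witt_ideal_mul (I J : qform F -> Prop) q : Prop :=
  exists (k : nat) (x y : 'I_k -> qform F),
    (forall i, I (x i) /\ J (y i)) /\
    witt_eq q (\big[qsum/qzero]_(i < k) qtensor (x i) (y i)).

Definition fund_ideal3 : qform F -> Prop :=
  witt_ideal_mul (witt_ideal_mul fund_ideal fund_ideal) fund_ideal.

Definition same_square_class (a b : F) := exists2 c : F, c != 0 & a = b * c ^+ 2.

(* Every binary anisotropic form represents at most 2 square classes. *)
Definition rigid :=
  forall q, qdim q = 2%N -> anisotropic q ->
  exists a b : F, [/\ a != 0, b != 0 &
    forall c, represents q c -> same_square_class c a \/ same_square_class c b].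

End Forms.

Arguments rigid F : clear implicits.

(* Main.v *)
Require Import Defs.
From HB Require Import structures.
From mathcomp Require Import all_boot all_order all_algebra.
From mathcomp.real_closed Require Import mxtens.
From mathcomp Require Import boolp zify ring.
From mathcomp Require classical_sets.

Set Implicit Arguments.
Unset Strict Implicit.
Unset Printing Implicit Defensive.

Import GRing.Theory.
Local Open Scope ring_scope.

(** Rigidity turns the Witt ring into a combinatorial object.  Let V be the
    group of square classes of F, written additively, and let eps in V be the
    class of -1.  A binary form over a rigid field has essentially one
    diagonalization, so that WF is the abelian group generated by V with the
    relations [v + eps] = - [v] and, if -1 is a sum of two squares, 4 [v] = 0.
    Instead of building this group, the proof works with the functions on V
    that factor through it ([witt_fun], or [admissible] for an abstract V):
    sums of their values over the entries of a diagonalization are invariants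
    of the Witt class ([form_sum_diag_iso], by Witt cancellation), and they
    determine the Witt class ([witt_eq_of_form_sum]).  The entries of a form
    similar to <1,a> <1,b> <1,d> are the eight points of [flat c a b d], so it
    remains to write an anisotropic list of 14 elements of V, on which every
    admissible function vanishing on flats vanishes, as a sum of two flats
    ([two_flats]).

    If eps = 0, then WF is the group ring of V over the field with two elements
    and the list is a subset S of V.  It lies in the cube of the augmentation
    ideal, hence is orthogonal to all polynomials of degree at most 2
    ([quad_even]).  Passing to V modulo a difference u of two points, which
    imitates the extension by the square root of u, removes the pairs {x, x+u}
    of S and lowers the size; iterating this shows that such an S is never of
    size 2, 4, 6 or 10, is a flat if it has 8 points, and is invariant under a
    translation if it has 12 points.  For 14 points some u is the difference of
    three pairs: otherwise a 12 point quotient occurs, and its invariance under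
    a yields at least three pairs with difference a or at least three with
    difference a + u.  The other 8 points then form a flat modulo u.
    Lifting this flat to V leaves an error t, t + u at a single point t, which
    completes the three pairs to a second flat meeting the first one only in t
    ([quad_even_size14]).

    If eps != 0, reduction modulo eps leads back to the previous case after
    cancelling equal pairs; 14, 12 or 8 points o are left, and the list consists of
    o and of a list m repeated twice.  For 14 points the signs must be adjusted
    so as to be affine on both flats, which holds because they satisfy the
    parity checks of the Hamming code ([pfister_sum_distinct]).  For 12 points,
    m is one point, and o splits into three pairs {x, x+a} and three pairs
    {x, x+a+eps}; since [m+a] + [m+a+eps] = 0, two copies of m complete these
    to two flats ([pfister_sum_twelve]).  For 8 points, lifting the flat leaves
    an error concentrated at one point, which together with the three points
    of m makes a second flat ([pfister_sum_eight]). *)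

(** * Characters of groups of exponent two *)

Section ElementaryTwoGroup.

Variable V : zmodType.
Hypothesis V2 : forall x : V, x + x = 0.

Definition character (f : V -> bool) := {morph f : x y / x + y >-> x (+) y}.

Lemma character0 f : character f -> f 0 = false.
Proof. by move=> fP; have := fP 0 0; rewrite addr0 addbb. Qed.

Lemma addVK (u x : V) : x + u + u = x.
Proof. by rewrite -addrA V2 addr0. Qed.

Lemma oppV (x : V) : - x = x.
Proof. by apply/eqP; rewrite eq_sym -addr_eq0 V2. Qed.

Lemma eqV (x y : V) : (x == y) = (x + y == 0).
Proof. by rewrite addr_eq0 oppV. Qed.

(** A subgroup maximal among those that avoid u has index 2: if it missed both x
    and x + u, adjoining x would give a larger one.  Its indicator function is
    the required character. *)
Lemma character_separates (u : V) : u != 0 -> exists2 f, character f & f u.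
Proof.
move=> u0.
pose P (A : classical_sets.set V) :=
  (forall x y, A x -> A y -> A (x + y)) /\ ~ A u.
(* The empty set is admitted, so that the empty chain is bounded; a maximal
   element contains 0 nevertheless. *)
have [F FP Ftot|A [[AD Au] maxA]] := @classical_sets.Zorn_bigcup V P.
  split=> [x y [B FB Bx] [C FC Cy]|[B /FP[_ Bu] /Bu//]].
  have [BC|CB] := Ftot _ _ FB FC.
    by exists C => //; apply: (FP _ FC).1 => //; apply: BC.
  by exists B => //; apply: (FP _ FB).1 => //; apply: CB.
have A0 : A 0.
  apply: contrapT => nA0.
  apply: (maxA (fun x => A x \/ x = 0)).
    by split=> [x Ax|E]; [left | apply: nA0; apply: E; right].
  split; last by case=> // /eqP; apply/negP.
  move=> x y [Ax|->] [Ay|->].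
  - by left; apply: AD.
  - by left; rewrite addr0.
  - by left; rewrite add0r.
  - by right; rewrite addr0.
have Acompl x : ~ A x -> A (x + u).
  move=> nAx; apply: contrapT => nAxu.
  apply: (maxA (fun y => A y \/ A (x + y))).
    by split=> [y Ay|E]; [left | apply: nAx; apply: E; right; rewrite V2].
  split; last by case.
  move=> y z [Ay|Ay] [Az|Az].
  - by left; apply: AD.
  - by right; rewrite addrCA; apply: AD.
  - by right; rewrite addrA; apply: AD.
  - by left; have := AD _ _ Ay Az; rewrite addrACA V2 add0r.
exists (fun x => `[< ~ A x >]) => [x y|]; last exact/asboolP.
case: (asboolP (~ A x)) => [nx|/contrapT Ax].
  case: (asboolP (~ A y)) => [ny|/contrapT Ay] /=.
    apply: asboolF; apply.
    have := AD _ _ (Acompl _ nx) (Acompl _ ny).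
    by rewrite addrACA V2 addr0.
  apply/asboolP => Axy; apply: nx.
  by have := AD _ _ Axy Ay; rewrite addVK.
case: (asboolP (~ A y)) => [ny|/contrapT Ay] /=.
  apply/asboolP => Axy; apply: ny.
  by have := AD _ _ Ax Axy; rewrite addrA V2 add0r.
by apply: asboolF; apply; apply: AD.
Qed.

Lemma character_ext (x y : V) :
  (forall f, character f -> f x = f y) -> x = y.
Proof.
move=> E; apply/eqP; apply: contraT; rewrite eqV => /character_separates[f fP].
by rewrite fP E // addbb.
Qed.

End ElementaryTwoGroup.

(** Identities in a group of exponent 2 are decided by evaluating characters,
    since characters separate points. *)
Ltac char2 V2 :=
  let f := fresh "f" in let fP := fresh "fP" in
  apply: (character_ext V2) => f fP;
  rewrite ?(fP, character0 fP);
  repeat match goal with |- context [f ?x] => case: (f x) end; reflexivity.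

(** The bits [P x] are generalised to arbitrary naturals first: [lia] would
    otherwise split on each of them. *)
Ltac count_lia :=
  repeat match goal with |- context [nat_of_bool ?b] => move: (nat_of_bool b) end;
  repeat match goal with |- context [count ?P ?s] => move: (count P s) end;
  clear; lia.

(** * Subsets orthogonal to quadratic polynomials *)

Section Codes.

Variable V : zmodType.
Hypothesis V2 : forall x : V, x + x = 0.
Implicit Types (u x y : V) (s t r : seq V) (f g : V -> bool).

(** The classes of the entries of a form similar to <1,a> <1,b> <1,d>, that is to
    the Pfister form <<-a,-b,-d>>.  The signs disappear in this notation, and a
    direction may be 0. *)
Definition flat (c a b d : V) : seq V :=
  [:: c; c + a; c + b; c + a + b; c + d; c + a + d; c + b + d; c + a + b + d].

(** The entries of <1,u> times a diagonal form. *)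
Definition doubled (u : V) (s : seq V) := s ++ [seq x + u | x <- s].

Lemma size_doubled u s : size (doubled u s) = (2 * size s)%N.
Proof. by rewrite size_cat size_map mul2n addnn. Qed.

(** For a list without repetition this says that its sum in the group algebra
    over the field with two elements lies in the cube of the augmentation ideal:
    products of two characters and the constant 1 span the polynomials of degree
    at most 2 (take f = g for the linear ones). *)
Definition quad_even s := ~~ odd (size s) /\
  forall f g, character f -> character g ->
    ~~ odd (count (fun x => f x && g x) s).

Lemma quad_even_perm s t : perm_eq s t -> quad_even s -> quad_even t.
Proof.
move=> st [s2 sq]; split=> [|f g fP gP]; first by rewrite -(perm_size st).
by rewrite -(permP st) sq.
Qed.

Lemma quad_even_cat s t : quad_even s -> quad_even (s ++ t) -> quad_even t.
Proof.
move=> [s2 sq] [st2 stq]; split=> [|f g fP gP].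
  by move: st2; rewrite size_cat oddD (negbTE s2).
by have := stq f g fP gP; rewrite count_cat oddD (negbTE (sq f g fP gP)).
Qed.

Lemma quad_even_map (p : V -> V) s :
  {morph p : x y / x + y} -> quad_even s -> quad_even (map p s).
Proof.
move=> pD [s2 sq]; split=> [|f g fP gP]; first by rewrite size_map.
by rewrite count_map; apply: (sq (f \o p) (g \o p)) => x y /=; rewrite pD.
Qed.

Lemma character_sum f s : character f -> f (\sum_(x <- s) x) = odd (count f s).
Proof.
move=> fP; elim: s => [|x s IH]; first by rewrite big_nil character0.
by rewrite big_cons fP IH /= oddD oddb.
Qed.

Lemma quad_even_sum s : quad_even s -> \sum_(x <- s) x = 0.
Proof.
move=> [_ sq]; apply: (character_ext V2) => f fP.
rewrite character0 // character_sum //; apply/negbTE.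
by rewrite -(eq_count (a1 := fun x => f x && f x)) ?sq // => x; rewrite /= andbb.
Qed.

Lemma quad_even_flat c a b d : quad_even (flat c a b d).
Proof.
split=> // f g fP gP; rewrite /= !fP !gP.
by case: (f c); case: (f a); case: (f b); case: (f d);
   case: (g c); case: (g a); case: (g b); case: (g d).
Qed.

(** The quotient of V by u, realized inside V as the kernel of a character f with
    f u = true.  This keeps a single group in play when quotients are iterated. *)
Definition proj f (u x : V) := if f x then x + u else x.

Section Projection.
Variables (f : V -> bool) (u : V).
Hypotheses (fP : character f) (fu : f u).

Lemma projD : {morph proj f u : x y / x + y}.
Proof.
move=> x y; rewrite /proj fP; case: (f x) (f y) => [] [] //=.
- by rewrite addrACA V2 addr0.
- by rewrite addrAC.
- by rewrite addrA.
Qed.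

Lemma proj_ker x : f (proj f u x) = false.
Proof. by rewrite /proj; case E: (f x); rewrite ?fP E ?fu. Qed.

Lemma proj_id x : f x = false -> proj f u x = x.
Proof. by rewrite /proj => ->. Qed.

Lemma projDu x : proj f u (x + u) = proj f u x.
Proof. by rewrite /proj fP fu; case: (f x); rewrite ?(addVK V2). Qed.

Lemma proj_inj x y : proj f u x = proj f u y -> x = y \/ x = y + u.
Proof.
rewrite /proj; case: (f x) (f y) => [] [].
- by move/addIr; left.
- by move<-; right; rewrite (addVK V2).
- by right.
- by left.
Qed.

Lemma proj_eq0 x : proj f u x = 0 -> x = 0 \/ x = u.
Proof.
have {1}-> : 0 = proj f u 0 by rewrite /proj character0.
by case/proj_inj => ->; [left | right; rewrite add0r].
Qed.

End Projection.

Lemma doubled_uniq_notin u t r x :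
  uniq (doubled u t ++ r) -> x \in t ->
  [/\ x + u \notin t, x \notin r & x + u \notin r].
Proof.
rewrite /doubled !cat_uniq => /and3P[/and3P[_ /hasPn D _] /hasPn E _] xt.
have xut : x + u \in [seq y + u | y <- t] by apply/mapP; exists x.
split; first exact: D.
  by apply/negP => /E; rewrite /= mem_cat xt.
by apply/negP => /E; rewrite /= mem_cat xut orbT.
Qed.

Lemma split_pairs u s : u != 0 -> uniq s -> exists t r,
  perm_eq s (doubled u t ++ r) /\ (forall x, x \in r -> x + u \notin r).
Proof.
move=> u0; have [n] := ubnP (size s); elim: n s => // n IH s.
rewrite ltnS => sn us.
have [/hasP[x xs xus]|/hasPn H] := boolP (has (fun x => x + u \in s) s); last first.
  by exists [::], s.
have xux : x + u != x by rewrite -subr_eq0 addrAC subrr add0r.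
have xus' : x + u \in rem x s by rewrite mem_rem_uniq // inE xux.
have e : perm_eq s [:: x, x + u & rem (x + u) (rem x s)].
  by rewrite (perm_trans (perm_to_rem xs)) // perm_cons perm_to_rem.
have [||t [r [p pr]]] := IH (rem (x + u) (rem x s)).
- by move: sn; rewrite (perm_size e) /=; lia.
- by rewrite !rem_uniq.
exists (x :: t), r; split=> //; apply: (perm_trans e).
apply/permP => P; have := permP p P; rewrite /doubled /= ?count_cat /= ?count_cat /=.
by move: (nat_of_bool (P (x + u))); lia.
Qed.

(** The pairs {x, x+u} vanish in the quotient by u, and the remaining points stay
    distinct there. *)
Lemma mod_pairs u s : u != 0 -> uniq s -> quad_even s -> exists t r f,
  [/\ perm_eq s (doubled u t ++ r) /\ (forall x, x \in r -> x + u \notin r),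
      character f, f u,
      uniq (map (proj f u) r) & quad_even (map (proj f u) r)].
Proof.
move=> u0 us qs; have [t [r [p pr]]] := split_pairs u0 us.
have [f fP fu] := character_separates V2 u0.
exists t, r, f; split=> //.
  rewrite map_inj_in_uniq; first by move: us; rewrite (perm_uniq p) cat_uniq; case/and3P.
  move=> x y xr yr /proj_inj[//|xy].
  by move: (pr y yr); rewrite -xy xr.
apply: (@quad_even_cat (map (proj f u) (doubled u t))).
  rewrite /doubled map_cat -map_comp (eq_map (projDu fP fu)).
  split=> [|g h gP hP]; first by rewrite size_cat oddD addbb.
  by rewrite count_cat oddD addbb.
by rewrite -map_cat; apply: (quad_even_map (projD u fP)); apply: quad_even_perm qs.
Qed.

Lemma two_in (s : seq V) : (1 < size s)%N -> uniq s ->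
  exists x y, [/\ x \in s, y \in s & x != y].
Proof.
case: s => [|x [|y s]] //= _; rewrite inE negb_or => /andP[/andP[xy _] _].
by exists x, y; rewrite !inE !eqxx orbT.
Qed.

(** A difference of two points of s yields at least one pair to remove. *)
Lemma ex_pair_mod s : (1 < size s)%N -> uniq s -> quad_even s ->
  exists u t r f, [/\ u != 0, perm_eq s (doubled u t ++ r) /\ (0 < size t)%N,
     character f /\ f u,
      uniq (map (proj f u) r) & quad_even (map (proj f u) r)].
Proof.
move=> s1 us qs; have [x [y [xs ys xy]]] := two_in s1 us.
have u0 : x + y != 0 by rewrite -(eqV V2).
have [t [r [f [[p pr] fP fu ur qr]]]] := mod_pairs u0 us qs.
exists (x + y), t, r, f; split=> //; split=> //.
case: t p => // p; move: xs ys; rewrite !(perm_mem p) /= => xr yr.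
by move: (pr x xr); rewrite addrA V2 add0r yr.
Qed.

Lemma count_split f h s :
  (count (fun x => f x && h x) s + count (fun x => ~~ f x && h x) s)%N = count h s.
Proof. by elim: s => //= x s <-; case: (f x) => /=; lia. Qed.

(** This is the residue of s along u: testing with f, for f u = true, counts one
    point out of each pair, which gives the parity of t; testing with f and a
    character killing u gives that the sum of t is trivial modulo u. *)
Lemma quad_even_doubled u t : u != 0 -> quad_even (doubled u t) ->
  ~~ odd (size t) /\ (\sum_(x <- t) x = 0 \/ \sum_(x <- t) x = u).
Proof.
move=> u0 [_ q]; have [f fP fu] := character_separates V2 u0.
split.
  have := q f f fP fP; rewrite count_cat count_map.
  rewrite (eq_count (a2 := f)) => [|x]; last by rewrite andbb.
  rewrite (@eq_count _ (preim _ _) (predC f)) => [|x]; last by rewrite /= fP fu addbT andbb.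
  by rewrite count_predC.
apply: (proj_eq0 fP); apply: (character_ext V2) => g gP.
pose h x := g (proj f u x).
have hP : character h by move=> x y; rewrite /h projD.
rewrite character0 // -[LHS]/(h _) character_sum //.
apply/negbTE; have := q f h fP hP; rewrite count_cat count_map.
rewrite (@eq_count _ (preim _ _) (fun x => ~~ f x && h x)) => [|x]; last first.
  by rewrite /= fP fu addbT /h projDu.
by rewrite count_split.
Qed.

Lemma quad_even_size_neq2 s : uniq s -> quad_even s -> size s != 2%N.
Proof.
move=> us /quad_even_sum; case: s us => [|x [|y []]] //=.
by rewrite inE andbT !big_cons big_nil addr0 => xy /eqP; rewrite -(eqV V2) (negbTE xy).
Qed.

Lemma mod_pairs_size s : (1 < size s)%N -> uniq s -> quad_even s ->
  exists u t (s' : seq V), [/\ u != 0, (0 < size t)%N /\ (size s = 2 * size t + size s')%N,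
    uniq s', quad_even s' & s' = [::] -> perm_eq s (doubled u t)].
Proof.
move=> s1 us qs; have [u [t [r [f [u0 [p t0] _ ur qr]]]]] := ex_pair_mod s1 us qs.
exists u, t, (map (proj f u) r); split=> //.
  by split=> //; rewrite (perm_size p) size_cat size_map size_doubled.
by case: r p {ur qr} => //; rewrite cats0.
Qed.

Lemma quad_even_size_neq4 s : uniq s -> quad_even s -> size s != 4%N.
Proof.
move=> us qs; apply/negP => /eqP s4.
have [|u [t [s' [u0 [t0]]]]] := mod_pairs_size _ us qs; first by rewrite s4.
rewrite s4 => es us' qs' H.
have := quad_even_size_neq2 us' qs'.
have [/size0nil/H p|s0] := eqVneq (size s') 0%N; last by move: es s0 t0; lia.
have := quad_even_doubled u0 (quad_even_perm p qs).
have st : size t = 2%N by have := perm_size p; rewrite s4 size_doubled; lia.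
move: us; rewrite (perm_uniq p); case: t st {es t0 p H} => [|x [|y []]] //= _.
rewrite !inE !big_cons big_nil addr0 /= andbT.
case/and3P => xD yD _ [_]; case.
  by move/eqP; rewrite -(eqV V2) => /eqP E; move: xD; rewrite E eqxx.
by move=> E; move: yD; rewrite -E addrA V2 add0r eqxx.
Qed.

Lemma quad_even_size_neq6 s : uniq s -> quad_even s -> size s != 6%N.
Proof.
move=> us qs; apply/negP => /eqP s6.
have [|u [t [s' [u0 [t0]]]]] := mod_pairs_size _ us qs; first by rewrite s6.
rewrite s6 => es us' qs' H.
have := quad_even_size_neq2 us' qs'; have := quad_even_size_neq4 us' qs'.
have [/size0nil/H p|s0] := eqVneq (size s') 0%N; last first.
  by move: es s0 t0; lia.
have [] := quad_even_doubled u0 (quad_even_perm p qs).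
by move: es; have := perm_size p; rewrite s6 size_doubled; lia.
Qed.

(** Four points with trivial sum modulo u form an affine plane modulo u. *)
Lemma doubled4_flat u x y z w :
  x + y + z + w = 0 \/ x + y + z + w = u ->
  perm_eq (doubled u [:: x; y; z; w]) (flat x (x + y) (x + z) u).
Proof.
move=> H; have -> : flat x (x + y) (x + z) u =
    [:: x; y; z; x + y + z; x + u; y + u; z + u; x + y + z + u].
  by congr [:: _; _; _; _; _; _; _; _]; char2 V2.
have [->|->] : w = x + y + z \/ w = x + y + z + u.
- have e : w = x + y + z + (x + y + z + w) by char2 V2.
  by case: H => E; [left|right]; rewrite e E ?addr0.
- by [].
rewrite /doubled /= (addVK V2).
by apply/permP => P /=; lia.
Qed.

(** No quotient has 2, 4 or 6 points, so the eight points are invariant under a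
    translation u and reduce to a plane modulo u. *)
Lemma quad_even_size8 s : uniq s -> quad_even s -> size s = 8%N ->
  exists c a b d, perm_eq s (flat c a b d).
Proof.
move=> us qs s8.
have [|u [t [s' [u0 [t0]]]]] := mod_pairs_size _ us qs; first by rewrite s8.
rewrite s8 => es us' qs' H.
have := quad_even_size_neq2 us' qs'; have := quad_even_size_neq4 us' qs'.
have := quad_even_size_neq6 us' qs'.
have [/size0nil/H p|s0] := eqVneq (size s') 0%N; last by move: es s0 t0; lia.
move=> _ _ _; have [_] := quad_even_doubled u0 (quad_even_perm p qs).
have st : size t = 4%N by have := perm_size p; rewrite s8 size_doubled; lia.
case: t st {es t0 H} p => [|x [|y [|z [|w []]]]] //= _ p.
rewrite !big_cons big_nil addr0 !addrA => /doubled4_flat p'.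
by exists x, (x + y), (x + z), u; apply: perm_trans p'.
Qed.

Definition bit (e : bool) u : V := if e then u else 0.

Lemma bitD e e' u : bit (e (+) e') u = bit e u + bit e' u.
Proof. by case: e e' => [] [] /=; rewrite ?addr0 ?add0r ?V2. Qed.

(** Replacing x by x + u at the positions selected by m, stated without
    subtraction: the unmodified points are added on the other side. *)
Lemma mask_twist u (m : bitseq) s : size m = size s ->
  perm_eq ([seq p.2 + bit p.1 u | p <- zip m s] ++ mask m s)
          (s ++ [seq x + u | x <- mask m s]).
Proof.
elim: m s => [|b m IH] [|x s] //= [/IH p].
apply/permP => P; have := permP p P; rewrite !count_cat /=.
case: b => /=; rewrite ?addr0 ?count_cat /= ?count_cat; last by lia.
by move: (nat_of_bool (P (x + u))); lia.
Qed.

Lemma proj_bit f u x : character f -> f u -> exists e, x = proj f u x + bit e u.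
Proof.
move=> fP fu; exists (f x); rewrite /proj /bit.
by case: (f x); rewrite ?addr0 ?(addVK V2).
Qed.

Lemma perm_map_lift (T : eqType) (p : V -> T) s (t : seq T) :
  perm_eq (map p s) t -> exists2 s', perm_eq s s' & map p s' = t.
Proof.
elim: t s => [|y t IH] s.
  by move/perm_nilP; case: s => // _; exists [::].
move=> e; have : y \in map p s by rewrite (perm_mem e) mem_head.
case/mapP => x xs ey.
have ps := perm_to_rem xs.
have [|s' p' <-] := IH (rem x s).
  rewrite -(perm_cons y) {1}ey -map_cons; apply: perm_trans e.
  by rewrite perm_sym; apply: perm_map.
exists (x :: s'); last by rewrite ey.
by apply: (perm_trans ps); rewrite perm_cons.
Qed.

(** The values of an affine function on the eight points of a flat, in the order
    of [flat]. *)
Definition affine8 (l0 la lb ld : bool) : bitseq :=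
  [:: l0; l0 (+) la; l0 (+) lb; l0 (+) la (+) lb; l0 (+) ld; l0 (+) la (+) ld;
      l0 (+) lb (+) ld; l0 (+) la (+) lb (+) ld].

Definition xor8 (m l : bitseq) := [seq p.1 (+) p.2 | p <- zip m l].

(** The first order Reed-Muller code of length 8 has covering radius 2. *)
Lemma affine_approx (t0 t1 t2 t3 t4 t5 t6 t7 : bool) : exists l0 la lb ld,
  (count id (xor8 [:: t0; t1; t2; t3; t4; t5; t6; t7] (affine8 l0 la lb ld)) <= 2)%N.
Proof.
suff: has (fun l => let: (l0, la, lb, ld) := l in
    (count id (xor8 [:: t0; t1; t2; t3; t4; t5; t6; t7] (affine8 l0 la lb ld)) <= 2)%N)
  [seq (p, q) | p <- [seq (p, q) | p <- [seq (p, q) | p <- [:: true; false],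
   q <- [:: true; false]], q <- [:: true; false]], q <- [:: true; false]].
  by case/hasP => -[[[l0 la] lb] ld] _ H; exists l0, la, lb, ld.
by case: t0; case: t1; case: t2; case: t3; case: t4; case: t5; case: t6; case: t7.
Qed.

Lemma map_flat (p : V -> V) c a b d : {morph p : x y / x + y} ->
  map p (flat c a b d) = flat (p c) (p a) (p b) (p d).
Proof. by move=> pD; rewrite /= !pD. Qed.

(** Points that form a flat modulo u differ from the points of a flat by multiples
    of u.  An affine change of these multiples is absorbed by changing the base
    point and the directions, so that at most two points T are displaced. *)
Lemma flat_lift f u r c a b d : character f -> f u ->
  uniq (flat c a b d) -> perm_eq (map (proj f u) r) (flat c a b d) ->
  exists c' a' b' d' T, [/\ (size T <= 2)%N, uniq T /\ {subset T <= flat c' a' b' d'},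
    uniq (flat c' a' b' d') & perm_eq (r ++ T) (flat c' a' b' d' ++ [seq x + u | x <- T])].
Proof.
move=> fP fu uf /perm_map_lift[r' p er].
case: r' p er => [|x0 [|x1 [|x2 [|x3 [|x4 [|x5 [|x6 [|x7 []]]]]]]]] //= p er.
have [t0 e0] := proj_bit x0 fP fu; have [t1 e1] := proj_bit x1 fP fu.
have [t2 e2] := proj_bit x2 fP fu; have [t3 e3] := proj_bit x3 fP fu.
have [t4 e4] := proj_bit x4 fP fu; have [t5 e5] := proj_bit x5 fP fu.
have [t6 e6] := proj_bit x6 fP fu; have [t7 e7] := proj_bit x7 fP fu.
have pk := proj_ker fP fu.
case: er => E0 E1 E2 E3 E4 E5 E6 E7.
have fc : f c = false by rewrite -E0.
have fa : f a = false by have := pk x1; rewrite E1 fP fc.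
have fb : f b = false by have := pk x2; rewrite E2 fP fc.
have fd : f d = false by have := pk x4; rewrite E4 fP fc.
have [l0 [la [lb [ld Hl]]]] := affine_approx t0 t1 t2 t3 t4 t5 t6 t7.
set m := xor8 _ _ in Hl.
pose c' := c + bit l0 u; pose a' := a + bit la u.
pose b' := b + bit lb u; pose d' := d + bit ld u.
have pbit x e : f x = false -> proj f u (x + bit e u) = x.
  by move=> fx; case: e; rewrite /= ?addr0 ?(projDu fP fu) proj_id.
have uf' : uniq (flat c' a' b' d').
  have : uniq (map (proj f u) (flat c' a' b' d')).
    by rewrite map_flat ?(pbit c, pbit a, pbit b, pbit d) //; apply: projD.
  exact: map_uniq.
exists c', a', b', d', (mask m (flat c' a' b' d')); split.
- by rewrite size_mask.
- by split; [apply: mask_uniq | move=> x /mem_mask].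
- exact: uf'.
have := @mask_twist u m (flat c' a' b' d') erefl.
have -> : [seq q.2 + bit q.1 u | q <- zip m (flat c' a' b' d')] =
    [:: x0; x1; x2; x3; x4; x5; x6; x7].
  rewrite e0 e1 e2 e3 e4 e5 e6 e7 E0 E1 E2 E3 E4 E5 E6 E7 /m /c' /a' /b' /d' /flat.
  rewrite [LHS]/= ?bitD.
  by congr [:: _; _; _; _; _; _; _; _]; char2 V2.
by apply: perm_trans; rewrite perm_cat2r.
Qed.

(** The difference of two points of a flat is a direction of the flat. *)
Lemma flat_shift c a b d y z : y \in flat c a b d -> z \in flat c a b d ->
  perm_eq [seq x + (y + z) | x <- flat c a b d] (flat c a b d).
Proof.
have pa s : perm_eq s (flat c a b d) -> perm_eq [seq x + a | x <- s] (flat c a b d).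
  move=> /(perm_map (fun x => x + a)) /perm_trans; apply.
  have -> : [seq x + a | x <- flat c a b d] =
     [:: c + a; c; c + a + b; c + b; c + a + d; c + d; c + a + b + d; c + b + d].
    by congr [:: _; _; _; _; _; _; _; _]; char2 V2.
  by apply/permP => P /=; lia.
have pb s : perm_eq s (flat c a b d) -> perm_eq [seq x + b | x <- s] (flat c a b d).
  move=> /(perm_map (fun x => x + b)) /perm_trans; apply.
  have -> : [seq x + b | x <- flat c a b d] =
     [:: c + b; c + a + b; c; c + a; c + b + d; c + a + b + d; c + d; c + a + d].
    by congr [:: _; _; _; _; _; _; _; _]; char2 V2.
  by apply/permP => P /=; lia.
have pd s : perm_eq s (flat c a b d) -> perm_eq [seq x + d | x <- s] (flat c a b d).
  move=> /(perm_map (fun x => x + d)) /perm_trans; apply.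
  have -> : [seq x + d | x <- flat c a b d] =
     [:: c + d; c + a + d; c + b + d; c + a + b + d; c; c + a; c + b; c + a + b].
    by congr [:: _; _; _; _; _; _; _; _]; char2 V2.
  by apply/permP => P /=; lia.
have pe e e' e'' : perm_eq [seq x + (bit e a + bit e' b + bit e'' d) | x <- flat c a b d]
    (flat c a b d).
  have := perm_refl (flat c a b d).
  have -> : [seq x + (bit e a + bit e' b + bit e'' d) | x <- flat c a b d] =
    [seq x + bit e a | x <- [seq x + bit e' b | x <- [seq x + bit e'' d | x <- flat c a b d]]].
    by rewrite -!map_comp; apply: eq_map => x /=; char2 V2.
  have aux w (p : forall s, perm_eq s (flat c a b d) -> perm_eq [seq x + w | x <- s] (flat c a b d))
     e0 s : perm_eq s (flat c a b d) -> perm_eq [seq x + bit e0 w | x <- s] (flat c a b d).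
    case: e0; first exact: p.
    by rewrite (eq_map (g := id)) ?map_id // => x; rewrite addr0.
  by move=> p; exact: (aux _ pa _ _ (aux _ pb _ _ (aux _ pd _ _ p))).
have co x : x \in flat c a b d -> exists e e' e'', x = c + (bit e a + bit e' b + bit e'' d).
  rewrite !inE => /or4P[/eqP->|/eqP->|/eqP->|/or4P[/eqP->|/eqP->|/eqP->|/orP[]/eqP->]];
  [ exists false, false, false | exists true, false, false | exists false, true, false
  | exists true, true, false | exists false, false, true | exists true, false, true
  | exists false, true, true | exists true, true, true]; rewrite /=; char2 V2.
move=> /co[e1 [e2 [e3 ->]]] /co[f1 [f2 [f3 ->]]].
have -> : c + (bit e1 a + bit e2 b + bit e3 d) + (c + (bit f1 a + bit f2 b + bit f3 d)) =
  bit (e1 (+) f1) a + bit (e2 (+) f2) b + bit (e3 (+) f3) d.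
  by rewrite !bitD; char2 V2.
exact: pe.
Qed.

End Codes.

Arguments flat : simpl never.

(** * Classification of the small codewords *)

Section Codes2.

Variable V : zmodType.
Hypothesis V2 : forall x : V, x + x = 0.
Implicit Types (u x y : V) (s t r : seq V) (f g : V -> bool).

Lemma sum_pair0 x y : x + y = 0 -> x = y.
Proof. by move/eqP; rewrite -(eqV V2) => /eqP. Qed.

Lemma sum_pairu u x y : x + y = u -> x = y + u.
Proof. by move<-; rewrite addrCA V2 addr0. Qed.

Lemma addu_neq u x : u != 0 -> x + u != x.
Proof. by move=> u0; rewrite -subr_eq0 addrAC subrr add0r. Qed.

Lemma size_split s u t r : perm_eq s (doubled u t ++ r) ->
  size s = (2 * size t + size r)%N.
Proof. by move=> p; rewrite (perm_size p) size_cat size_doubled. Qed.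

(** If the quotient by u has eight points, then s equals a flat plus the points of
    t and T doubled along u; both s and the flat being orthogonal to quadratic
    polynomials, so is the doubled part, and [quad_even_doubled] applies. *)
Lemma mod_flat s u t r f : u != 0 -> quad_even s ->
  perm_eq s (doubled u t ++ r) -> character f -> f u ->
  uniq (map (proj f u) r) -> quad_even (map (proj f u) r) -> size r = 8%N ->
  exists c a b d T, [/\ (size T <= 2)%N /\ ~~ odd (size t + size T),
    uniq T /\ {subset T <= flat c a b d}, uniq (flat c a b d),
    perm_eq (r ++ T) (flat c a b d ++ [seq x + u | x <- T]) &
    \sum_(x <- t ++ T) x = 0 \/ \sum_(x <- t ++ T) x = u].
Proof.
move=> u0 qs p fP fu ur qr r8.
have [|c0 [a0 [b0 [d0 pr]]]] := quad_even_size8 V2 ur qr; first by rewrite size_map.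
have uf : uniq (flat c0 a0 b0 d0) by rewrite -(perm_uniq pr).
have [c [a [b [d [T [T2 sT uf' pT]]]]]] := flat_lift V2 fP fu uf pr.
exists c, a, b, d, T.
have q : quad_even (doubled u (t ++ T)).
  apply: (quad_even_cat (quad_even_flat c a b d)).
  apply: (@quad_even_perm _ ((T ++ T) ++ s)); last first.
    case: qs => s2 qs; split=> [|g h gP hP].
      by rewrite !size_cat !oddD addbb (negbTE s2).
    by rewrite !count_cat !oddD addbb (negbTE (qs g h gP hP)).
  apply/permP => P; have := permP p P; have := permP pT P.
  by rewrite /doubled map_cat !count_cat; count_lia.
by have [] := quad_even_doubled V2 u0 q; rewrite size_cat.
Qed.

Lemma lift_mem_shift u c a b d r T y : u != 0 -> T = [:: y] ->
  perm_eq (r ++ T) (flat c a b d ++ [seq x + u | x <- T]) -> y + u \in r.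
Proof.
move=> u0 -> p; have : y + u \in r ++ [:: y].
  by rewrite (perm_mem p) mem_cat mem_seq1 eqxx orbT.
by rewrite mem_cat mem_seq1 (negbTE (addu_neq _ u0)) orbF.
Qed.

(** The only possible quotient is a flat, with one pair {x, x+u} and one displaced
    point y; the residue forces x = y modulo u, contradicting uniqueness. *)
Lemma quad_even_size_neq10 s : uniq s -> quad_even s -> size s != 10%N.
Proof.
move=> us qs; apply/negP => /eqP s10.
have [|u [t [r [f [u0 [p t0] [fP fu] ur qr]]]]] := ex_pair_mod V2 _ us qs.
  by rewrite s10.
have := size_split p; rewrite s10 => e.
have := quad_even_size_neq2 V2 ur qr; have := quad_even_size_neq4 V2 ur qr.
have := quad_even_size_neq6 V2 ur qr; rewrite size_map => n6 n4 n2.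
have [/size0nil r0|r0] := eqVneq (size r) 0%N.
  rewrite r0 cats0 in p.
  have [] := quad_even_doubled V2 u0 (quad_even_perm p qs).
  by move: e; rewrite r0 /=; lia.
have r8 : size r = 8%N by lia.
have [c [a [b [d [T [[T2 oT] [uT sT] uf pT sum]]]]]] := mod_flat u0 qs p fP fu ur qr r8.
have t1 : size t = 1%N by lia.
have T1 : size T = 1%N by move: oT T2; rewrite t1; case: (size T) => [|[|[]]].
case: t t1 {t0 e oT} p sum => [|x []] //= _ p.
case: T T1 {uT} sT pT {T2} => [|y []] //= _ _ pT.
have yr := lift_mem_shift u0 erefl pT.
have := us; rewrite (perm_uniq p) => ud.
have [_ xr xur] := @doubled_uniq_notin _ u [:: x] r x ud (mem_head x [::]).
rewrite !big_cons big_nil addr0; case.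
  by move/sum_pair0 => xy; move: xur; rewrite xy yr.
by move/sum_pairu => xy; move: xr; rewrite xy yr.
Qed.

Lemma shift_invariant_doubled s a : a != 0 -> uniq s ->
  perm_eq [seq x + a | x <- s] s -> exists t, perm_eq s (doubled a t).
Proof.
move=> a0 us inv; have [t [r [p pr]]] := split_pairs a0 us.
exists t; case: r p pr => [|x r] p pr; first by rewrite cats0 in p.
have xs : x \in s by rewrite (perm_mem p) mem_cat mem_head orbT.
have : x + a \in s by rewrite -(perm_mem inv); apply/mapP; exists x.
rewrite (perm_mem p) mem_cat (negbTE (pr x (mem_head _ _))) orbF.
move: us; rewrite (perm_uniq p) => ud.
rewrite mem_cat => /orP[xt|/mapP[y yt /addIr xy]].
  have [_ _] := doubled_uniq_notin ud xt.
  by rewrite (addVK V2) mem_head.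
have [_] := doubled_uniq_notin ud yt.
by rewrite -xy mem_head.
Qed.

(** If the quotient is a flat, with two pairs starting at x and y, then its lift
    displaces two points z and w, and x + y = z + w modulo u.  The flat, its two
    displaced points and the two pairs are invariant under z + w. *)
Lemma quad_even_size12 s : uniq s -> quad_even s -> size s = 12%N ->
  exists (a : V) t, a != 0 /\ perm_eq s (doubled a t).
Proof.
move=> us qs s12.
have [|u [t [r [f [u0 [p t0] [fP fu] ur qr]]]]] := ex_pair_mod V2 _ us qs.
  by rewrite s12.
have := size_split p; rewrite s12 => e.
have := quad_even_size_neq2 V2 ur qr; have := quad_even_size_neq4 V2 ur qr.
have := quad_even_size_neq6 V2 ur qr; have := quad_even_size_neq10 ur qr.
rewrite size_map => n10 n6 n4 n2.
have [/size0nil r0|r0] := eqVneq (size r) 0%N.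
  by rewrite r0 cats0 in p; exists u, t.
have r8 : size r = 8%N by lia.
have [c [a [b [d [T [[T2 oT] [uT sT] uf pT sum]]]]]] := mod_flat u0 qs p fP fu ur qr r8.
have t2 : size t = 2%N by lia.
have := us; rewrite (perm_uniq p) => ud.
case: t t2 {t0 e} p sum oT ud => [|x [|y []]] //= _ p sum oT ud.
have [xut _ _] := @doubled_uniq_notin _ u [:: x; y] r x ud (mem_head x [:: y]).
have xy : x != y.
  by move: ud => /= /andP[]; rewrite inE negb_or => /andP[].
case: T T2 oT uT sT pT sum => [|z [|w []]] //= _ _ uT sT pT.
  rewrite !big_cons big_nil addr0; case.
    by move/sum_pair0/eqP; rewrite (negbTE xy).
  by move/sum_pairu => E; move: xut; rewrite E (addVK V2) !inE eqxx orbT.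
move=> sum; have zw : z != w.
  by move: uT; rewrite inE andbT.
have zf : z \in flat c a b d by apply: sT; rewrite mem_head.
have wf : w \in flat c a b d by apply: sT; rewrite !inE eqxx orbT.
have a0 : z + w != 0 by rewrite -(eqV V2).
suff inv : perm_eq [seq x0 + (z + w) | x0 <- s] s.
  by have [t' pt'] := shift_invariant_doubled a0 us inv; exists (z + w), t'.
have pf := flat_shift V2 zf wf.
set e := z + w in pf a0 *.
have za : z + e = w by rewrite addrA V2 add0r.
have wa : w + e = z by rewrite addrCA V2 addr0.
have pr : perm_eq [seq x0 + e | x0 <- r] r.
  apply/permP => P; have := permP (perm_map (fun x0 => x0 + e) pT) P.
  have := permP pT P; have := permP pf P.
  rewrite !map_cat !count_cat /= ![_ + u + e]addrAC za wa.
  by count_lia.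
have [ya|ya] : y = x + e \/ y = x + e + u.
- have E' : y = x + e + (x + (y + (z + w))) by rewrite /e; char2 V2.
  move: sum; rewrite !big_cons big_nil addr0; case=> E; [left | right].
    by rewrite E' E addr0.
  by rewrite E' E.
- apply/permP => P; have := permP (perm_map (fun x0 => x0 + e) p) P.
  rewrite (permP p) => ->; rewrite /= (permP pr) ya.
  rewrite ![_ + u + e]addrAC !(addVK V2).
  by count_lia.
apply/permP => P; have := permP (perm_map (fun x0 => x0 + e) p) P.
rewrite (permP p) => ->; rewrite /= (permP pr) ya.
rewrite !(addVK V2) ![_ + u + e]addrAC !(addVK V2).
by count_lia.
Qed.


Lemma flat_rebase c a b d y : y \in flat c a b d ->
  perm_eq (flat y a b d) (flat c a b d).
Proof.
move=> yf; have := flat_shift V2 (mem_head c _) yf.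
have -> // : [seq x + (c + y) | x <- flat c a b d] = flat y a b d.
by congr [:: _; _; _; _; _; _; _; _]; char2 V2.
Qed.

(** The two flats meet only in p, and s consists of their 14 other points. *)
Lemma quad_even_size14 s : uniq s -> quad_even s -> size s = 14%N ->
  exists p a b d a' b' d', uniq (p :: behead (flat p a b d) ++ behead (flat p a' b' d')) /\
    perm_eq s (behead (flat p a b d) ++ behead (flat p a' b' d')).
Proof.
move=> us qs s14.
(* It suffices to find u with at least three pairs {x, x+u} in s. *)
suff [u [t [u0 t3]]] : exists u t, [/\ u != 0, (2 < size t)%N & exists r f,
    [/\ perm_eq s (doubled u t ++ r), character f, f u,
    uniq (map (proj f u) r) & quad_even (map (proj f u) r)]].
  move=> [r [f [p fP fu ur qr]]].
  have := size_split p; rewrite s14 => e.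
  have := quad_even_size_neq2 V2 ur qr; have := quad_even_size_neq4 V2 ur qr.
  have := quad_even_size_neq6 V2 ur qr; rewrite size_map => n6 n4 n2.
  have [/size0nil r0|r0] := eqVneq (size r) 0%N.
    rewrite r0 cats0 in p.
    have [] := quad_even_doubled V2 u0 (quad_even_perm p qs).
    by move: e; rewrite r0 /=; lia.
  have r8 : size r = 8%N by lia.
  have [c [a [b [d [T [[T2 oT] [uT sT] uf pT sum]]]]]] := mod_flat u0 qs p fP fu ur qr r8.
  have {e}t3 : size t = 3%N by lia.
  have T1 : size T = 1%N by move: oT T2; rewrite t3; case: (size T) => [|[|[]]].
  have := us; rewrite (perm_uniq p) => ud.
  case: T T1 uT sT pT sum {T2 oT} => [|y []] // _ _ sT pT sum.
  have yf : y \in flat c a b d by apply: sT; rewrite mem_head.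
  have yr := lift_mem_shift u0 erefl pT.
  have yt : y \notin t.
    by apply/negP => /(doubled_uniq_notin ud)[_ _]; rewrite yr.
  have yut : y + u \notin t.
    by apply/negP => /(doubled_uniq_notin ud)[_]; rewrite yr.
  case: t t3 p sum ud yt yut => [|x [|z [|w []]]] // _ p sum ud yt yut.
  have {}sum : y + x + z + w = 0 \/ y + x + z + w = u.
    move: sum; rewrite !big_cons big_nil addr0.
    by have -> : x + (z + (w + y)) = y + x + z + w by char2 V2.
  have pQ := doubled4_flat V2 sum.
  have pf := flat_rebase yf.
  have ps : perm_eq s (behead (flat y a b d) ++ behead (flat y (y + x) (y + z) u)).
    apply/permP => P; rewrite (permP p) !count_cat.
    have := permP pT P; have := permP pf P; have := permP pQ P.
    rewrite -[flat y a b d]/(y :: behead (flat y a b d)).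
    rewrite -[flat y (y + x) _ u]/(y :: behead (flat y (y + x) (y + z) u)).
    rewrite !count_cat /doubled /= ?count_cat /=.
    by count_lia.
  exists y, a, b, d, (y + x), (y + z), u; split=> //.
  rewrite cons_uniq -(perm_uniq ps) us andbT mem_cat.
  rewrite negb_or; apply/andP; split.
    by have := uf; rewrite -(perm_uniq pf) => /andP[].
  have : perm_eq (behead (flat y (y + x) (y + z) u)) [:: x; z; w; y + u; x + u; z + u; w + u].
    rewrite -(perm_cons y); rewrite perm_sym; exact: pQ.
  move/perm_mem => ->; move: yt yut.
  have xu v : (y == v + u) = (y + u == v) by rewrite -[in RHS](inj_eq (addIr u)) (addVK V2).
  rewrite !inE !negb_or !xu => /and3P[-> -> ->] /and3P[-> -> ->].
  by rewrite addu_neq.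
have [|u [t [r [f [u0 [p t0] [fP fu] ur qr]]]]] := ex_pair_mod V2 _ us qs.
  by rewrite s14.
have [t3|t3] := leqP 3 (size t); first by exists u, t; split=> //; exists r, f.
have := size_split p; rewrite s14 => e.
have := quad_even_size_neq10 ur qr; rewrite size_map => n10.
have r12 : size r = 12%N by lia.
have [|a [t' [a0 p']]] := quad_even_size12 ur qr; first by rewrite size_map.
(* The 12 point quotient is invariant under a, so each point x of r has x + a or
   x + a + u in s; one of these two differences serves at least three pairs. *)
pose D v := count (fun x => x + v \in s) s.
have D_le v t1 r1 : perm_eq s (doubled v t1 ++ r1) -> (forall x, x \in r1 -> x + v \notin r1) ->
   (D v <= 2 * size t1)%N.
  move=> p1 n1; rewrite /D (permP p1) count_cat -[leqRHS]addn0 leq_add //.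
    by rewrite -(size_doubled v) count_size.
  rewrite leqn0 -leqn0 leqNgt -has_count; apply/hasPn => x xr.
  have ud : uniq (doubled v t1 ++ r1) by rewrite -(perm_uniq p1).
  rewrite (perm_mem p1) mem_cat (negbTE (n1 x xr)) orbF mem_cat negb_or.
  apply/andP; split; apply/negP.
    by case/(doubled_uniq_notin ud) => _ _; rewrite (addVK V2) xr.
  by case/mapP => z zt /addIr xz; case: (doubled_uniq_notin ud zt); rewrite -xz xr.
have fa : f a = false.
  have t'0 : (0 < size t')%N.
    by have := perm_size p'; rewrite size_map r12 size_doubled; case: (size t').
  have [z zt] : exists z, z \in t' by case: (t') t'0 => // z ? _; exists z; rewrite mem_head.
  have fr v : v \in map (proj f u) r -> f v = false.
    by case/mapP => w _ ->; rewrite proj_ker.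
  have fz : f z = false by rewrite fr // (perm_mem p') mem_cat zt.
  have : f (z + a) = false.
    by rewrite fr // (perm_mem p') mem_cat; apply/orP; right; apply/mapP; exists z.
  by rewrite fP fz.
have D12 : (12 <= D a + D (a + u)%R)%N.
  rewrite -count_predUI; apply: (leq_trans _ (leq_addr _ _)).
  rewrite (permP p) count_cat; apply: (leq_trans _ (leq_addl _ _)).
  rewrite -r12 -[leqLHS](count_predT r) (@eq_in_count _ _ predT r) // => x xr /=.
  have : proj f u x + a \in map (proj f u) r.
    have : proj f u x \in map (proj f u) r by apply: map_f.
    rewrite !(perm_mem p') !mem_cat => /orP[xt|/mapP[z zt ->]].
      by apply/orP; right; apply/mapP; exists (proj f u x).
    by rewrite (addVK V2) zt.
  rewrite -{1}(proj_id u fa) -(projD V2 u fP) => /mapP[z zr /esym/(proj_inj V2)].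
  have zs : z \in s by rewrite (perm_mem p) mem_cat zr orbT.
  by case=> e'; rewrite ?addrA -e' zs ?orbT.
suff [v [v0 Dv]] : exists v, v != 0 /\ (6 <= D v)%N.
  have [t1 [r1 [f1 [[p1 n1] f1P f1v ur1 qr1]]]] := mod_pairs V2 v0 us qs.
  exists v, t1; split=> //; last by exists r1, f1.
  by have := leq_trans Dv (D_le _ _ _ p1 n1); lia.
have [D6|D6] := leqP 6 (D a); first by exists a.
exists (a + u); split; last by move: D12 D6; clear; lia.
by apply/eqP => /sum_pair0 au; move: fu; rewrite -au fa.
Qed.

End Codes2.

Arguments flat : simpl never.
Arguments doubled : simpl never.

(** * Signed flats *)

Lemma dvd4_parity (b : bool) m n k :
  (4 %| b + m -> 4 %| b + n -> 4 %| m + n + 2 * k -> b (+) odd k = false)%N.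
Proof.
move=> /dvdnP[k1 E1] /dvdnP[k2 E2] /dvdnP[k3 E3].
by case: b E1 E2 => E1 E2; rewrite /=; lia.
Qed.

Lemma dvd4_14 k : (4 %| 14 + 2 * k)%N -> odd k.
Proof. by move=> /dvdnP[k1 E1]; lia. Qed.

Lemma dvd4_span (b b' : bool) k0 k1 j :
  (4 %| 2 * k0 + (2 * k1 + 2 * b) + 2 * (2 * j + (k1 + 2 * b')) -> odd k0 (+) b = false)%N.
Proof. by move=> /dvdnP[k1' E1]; case: b b' E1 => [] [] /=; lia. Qed.

Lemma dvd4_33 (b b' : bool) c0 c' n : (c' + n = 3 ->
  4 %| 3 + (3 + 2 * b) + 2 * (c0 + (n + 2 * b')) -> b (+) odd c0 (+) odd c' = false)%N.
Proof. by move=> cn /dvdnP[k1 E1]; case: b b' E1 => [] [] /=; lia. Qed.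

Lemma dvd8_33 (b : bool) c0 :
  (8 %| 14 + 6 * (2 * c0 + (3 + 2 * b)) -> odd c0 (+) b = false)%N.
Proof. by move=> /dvdnP[k1 E1]; case: b E1 => /=; lia. Qed.

Lemma dvd8_15 (b b' : bool) :
  (8 %| 14 + 6 * (2 * b + (5 + 2 * b')) -> b (+) b')%N.
Proof. by case: b b' => [] []. Qed.

Lemma dvd4_sizes c0 n (b : bool) :
  (4 %| 14 + 2 * (2 * c0 + (n + 2 * b)) -> odd n)%N.
Proof. by move=> /dvdnP[k1 E1]; case: b E1 => /=; lia. Qed.

Lemma dvd4_lift_size co cm cF ct cn :
  (4 %| 14 + 2 * (co + (cm + cm)) -> 4 %| cF -> co + ct = cF + cn -> odd (ct + cn))%N.
Proof. by move=> /dvdnP[k1 E1] /dvdnP[k2 E2]; lia. Qed.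

Lemma dvd4_lift (b c : bool) k m l K cx :
  (4 %| k + (m + m) + 2 * (cx + (l + l)) -> 4 %| k -> ~~ odd K ->
   cx + (b && c) = K + (b && ~~ c) -> b (+) odd m = false)%N.
Proof.
by move=> /dvdnP[k1 E1] /dvdnP[k2 E2]; case: b c => [] [] /=; lia.
Qed.

Lemma dvd8_lift (c : bool) co cm cF :
  (8 %| 14 + 6 * (co + (cm + cm)) -> 4 %| cF -> co + c = cF + ~~ c ->
   c (+) true (+) odd cm = false)%N.
Proof.
by move=> /dvdnP[k1 E1] /dvdnP[k2 E2]; case: c => /=; lia.
Qed.

(** Here V stands for the square classes of a rigid field, [eps] for the class of
    -1, and [four0] for the condition that -1 is a sum of two squares, that is
    that 4 = 0 in the Witt ring. *)
Section Witt.

Variable V : zmodType.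
Hypothesis V2 : forall x : V, x + x = 0.
Variables (eps : V) (four0 : Prop).
Implicit Types (a b c d u x y : V) (s t r : seq V) (f g : V -> bool).

(** The functions on V that extend to the Witt group. *)
Definition admissible (A : zmodType) (h : V -> A) :=
  (forall x, h (x + eps) = - h x) /\ (four0 -> forall x, h x *+ 4 = 0).

Definition wsum (A : zmodType) (h : V -> A) s := \sum_(x <- s) h x.

(** Membership of the Witt class in the subgroup generated by the flats, expressed
    by duality. *)
Definition in_I3 s := forall (A : zmodType) (h : V -> A), admissible h ->
  (forall c a b d, wsum h (flat c a b d) = 0) -> wsum h s = 0.

Lemma Zp_nat_eq0 m k : (1 < m)%N -> (k%:R == 0 :> 'Z_m) = (m %| k)%N.
Proof.
by move=> m1; rewrite -val_eqE /= val_Zp_nat // /dvdn.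
Qed.

(** Test functions with values in Z/m, given by their natural representatives. *)
Lemma I3_test m (w : V -> nat) s : (1 < m)%N -> in_I3 s ->
  (forall x, m %| w x + w (x + eps)%R)%N -> (four0 -> (m %| 4)%N) ->
  (forall c a b d, m %| \sum_(x <- flat c a b d) w x)%N ->
  (m %| \sum_(x <- s) w x)%N.
Proof.
move=> m1 sI we m4 wf.
pose h x : 'Z_m := (w x)%:R.
have E t : wsum h t = (\sum_(x <- t) w x)%:R by rewrite /wsum natr_sum.
rewrite -Zp_nat_eq0 // -E; apply/eqP; apply: sI => [|c a b d]; last first.
  by apply/eqP; rewrite E Zp_nat_eq0.
split=> [x|/m4 m4' x].
  by apply/eqP; rewrite -addr_eq0 addrC -natrD Zp_nat_eq0.
by apply/eqP; rewrite -mulrnA Zp_nat_eq0 // dvdn_mull.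
Qed.

Lemma sum_nat_count (w : V -> nat) f s : (forall x, w x = f x :> nat) ->
  (\sum_(x <- s) w x)%N = count f s.
Proof.
by move=> wE; rewrite -sum1_count [RHS]big_mkcond; apply: eq_bigr => x _; rewrite wE; case: (f x).
Qed.

Lemma I3_test_quadratic s f g : in_I3 s -> character f -> character g ->
  f eps = false -> g eps = false -> ~~ odd (count (fun x => f x && g x) s).
Proof.
move=> sI fP gP fe ge; rewrite -dvdn2 -(sum_nat_count _ (w := fun x => f x && g x)) //.
apply: I3_test => // [x|c a b d].
  by rewrite fP gP fe ge !addbF addnn -mul2n dvdn_mulr.
by rewrite (sum_nat_count (f := fun x => f x && g x)) // dvdn2; have [_ ->] := quad_even_flat c a b d.
Qed.

Section Sign.
Variables (chi : V -> bool).
Hypotheses (chiP : character chi) (chie : chi eps).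

(** The test function is f, with sign given by chi, in Z/4; the residue of the
    sign -1 is represented by 3 = 1 + 2. *)
Lemma I3_test_mod4 s f : in_I3 s -> character f -> f eps = false ->
  (4 %| count f s + 2 * count (fun x => f x && chi x) s)%N.
Proof.
move=> sI fP fe.
have E t : (\sum_(x <- t) (f x + 2 * (f x && chi x)) =
   count f t + 2 * count (fun x => f x && chi x) t)%N.
  by rewrite big_split -big_distrr /= (sum_nat_count _ (f := f)) // (sum_nat_count _ (f := fun x => f x && chi x)).
rewrite -E; apply: I3_test => // [x|c a b d].
  by rewrite fP chiP fe chie addbF; case: (f x); case: (chi x).
rewrite /flat !big_cons big_nil !fP !chiP.
by case: (f c); case: (f a); case: (f b); case: (f d);
  case: (chi c); case: (chi a); case: (chi b); case: (chi d).
Qed.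

Lemma I3_test_size_mod4 s : in_I3 s -> (4 %| size s + 2 * count chi s)%N.
Proof.
move=> sI.
have E t : (\sum_(x <- t) (true + 2 * (chi x)) = size t + 2 * count chi t)%N.
  by rewrite big_split -big_distrr /= (sum_nat_count _ (f := predT)) // (sum_nat_count _ (f := chi)) // count_predT.
rewrite -E; apply: I3_test => // [x|c a b d].
  by rewrite chiP chie; case: (chi x).
rewrite /flat !big_cons big_nil !chiP.
by case: (chi c); case: (chi a); case: (chi b); case: (chi d).
Qed.

(** The test function is the signature attached to chi, modulo 8; the sign -1 is
    represented by 7 = 1 + 6.  It is admissible when 4 = 0 is not imposed. *)
Lemma I3_test_mod8 s : ~ four0 -> in_I3 s -> (8 %| size s + 6 * count chi s)%N.
Proof.
move=> nfl sI.
have E t : (\sum_(x <- t) (true + 6 * (chi x)) = size t + 6 * count chi t)%N.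
  by rewrite big_split -big_distrr /= (sum_nat_count _ (f := predT)) // (sum_nat_count _ (f := chi)) // count_predT.
rewrite -E; apply: I3_test => // [x|c a b d].
  by rewrite chiP chie; case: (chi x).
rewrite /flat !big_cons big_nil !chiP.
by case: (chi c); case: (chi a); case: (chi b); case: (chi d).
Qed.

End Sign.

Lemma wsum_cat (A : zmodType) (h : V -> A) s t : wsum h (s ++ t) = wsum h s + wsum h t.
Proof. exact: big_cat. Qed.

Lemma wsum_perm (A : zmodType) (h : V -> A) s t : perm_eq s t -> wsum h s = wsum h t.
Proof. by move=> p; apply: perm_big. Qed.

Lemma wsum_cons (A : zmodType) (h : V -> A) x s : wsum h (x :: s) = h x + wsum h s.
Proof. exact: big_cons. Qed.

Definition pfister_sum s := exists c a b d c' a' b' d', forall (A : zmodType) (h : V -> A),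
  admissible h -> wsum h s = wsum h (flat c a b d) + wsum h (flat c' a' b' d').

(** Equal entries are cancelled in pairs; m lists one entry of each pair. *)
Lemma odd_part (T : eqType) (l : seq T) : exists o m, perm_eq l (o ++ m ++ m) /\ uniq o.
Proof.
elim: l => [|x l [o [m [p uo]]]]; first by exists [::], [::].
have [xo|xo] := boolP (x \in o).
  exists (rem x o), (x :: m); split; last by rewrite rem_uniq.
  apply: (perm_trans (y := x :: o ++ m ++ m)); first by rewrite perm_cons.
  have := perm_to_rem xo => po; apply/permP => P; have := permP po P.
  by rewrite /= !count_cat /= count_cat /= /=; count_lia.
by exists (x :: o), m; split=> /=; [rewrite perm_cons | rewrite xo].
Qed.

(** Multiplies by -1 the entries of s selected by E. *)
Definition twist (E : bitseq) s := [seq q.2 + bit q.1 eps | q <- zip E s].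

Lemma flat_count4 f c a b d : character f -> (4 %| count f (flat c a b d))%N.
Proof.
move=> fP; rewrite /flat /= !fP.
by case: (f c); case: (f a); case: (f b); case: (f d).
Qed.

Lemma count_twist f E s : character f -> f eps = false -> size E = size s ->
  count f (twist E s) = count f s.
Proof.
move=> fP fe; rewrite /twist; elim: E s => [|e E IH] [|x s] //= [/IH ->].
by rewrite fP; case: e; rewrite /= ?fe ?(character0 fP) addbF.
Qed.

Lemma count_twist_sign chi f E s : character chi -> chi eps -> character f -> f eps = false ->
  size E = size s -> {in s, forall x, chi x = false} ->
  count (fun x => f x && chi x) (twist E s) = count (fun q => q.1 && f q.2) (zip E s).
Proof.
move=> chiP chie fP fe; rewrite /twist; elim: E s => [|e E IH] [|x s] //= [sE] ks.
rewrite IH // => [|y ys]; last by rewrite ks // inE ys orbT.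
rewrite fP chiP (ks x) ?mem_head //.
by case: e; rewrite /= ?chie ?fe ?(character0 chiP) ?(character0 fP) ?andbF ?addbF ?andbT.
Qed.

Lemma count_ker_zip chi E s : {in s, forall x, chi x = false} ->
  count (fun q => q.1 && chi q.2) (zip E s) = 0%N.
Proof.
elim: E s => [|e E IH] [|x s] // ks; rewrite /= IH => [|y ys]; last first.
  by rewrite ks // inE ys orbT.
by rewrite (ks x) ?mem_head // andbF.
Qed.

Lemma count_sign_twist chi E s : character chi -> chi eps ->
  size E = size s -> {in s, forall x, chi x = false} ->
  count chi (twist E s) = count id E.
Proof.
move=> chiP chie; rewrite /twist; elim: E s => [|e E IH] [|x s] //= [sE] ks.
rewrite IH // => [|y ys]; last by rewrite ks // inE ys orbT.
by rewrite chiP (ks x) ?mem_head //; case: e; rewrite /= ?chie ?character0.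
Qed.

Definition select (E : bitseq) s := \sum_(q <- zip E s) bit q.1 q.2.

Lemma character_select f E s : character f ->
  f (select E s) = odd (count (fun q => q.1 && f q.2) (zip E s)).
Proof.
move=> fP; rewrite /select; elim: E s => [|e E IH] [|x s];
  rewrite ?big_nil ?character0 //=.
by rewrite big_cons fP IH oddD; case: e; rewrite /= ?(character0 fP) // oddb.
Qed.

Lemma character_bit f e x : character f -> f (bit e x) = e && f x.
Proof. by move=> fP; case: e => //=; rewrite character0. Qed.

Lemma select_flat e0 e1 e2 e3 e4 e5 e6 c a b d :
  select [:: e0; e1; e2; e3; e4; e5; e6] (behead (flat c a b d)) =
  bit (e0 (+) e1 (+) e2 (+) e3 (+) e4 (+) e5 (+) e6) c +
  (bit (e0 (+) e2 (+) e4 (+) e6) a + bit (e1 (+) e2 (+) e5 (+) e6) b +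
   bit (e3 (+) e4 (+) e5 (+) e6) d).
Proof.
apply: (character_ext V2) => f fP.
rewrite /select /flat /= !big_cons big_nil /= !fP !character_bit // !fP character0 //.
by case: (f c); case: (f a); case: (f b); case: (f d); rewrite /= ?andbT ?andbF;
  case: e0; case: e1; case: e2; case: e3; case: e4; case: e5; case: e6.
Qed.

Lemma flat_dir_mem (l1 l2 l3 : bool) c a b d : [|| l1, l2 | l3] ->
  c + (bit l1 a + bit l2 b + bit l3 d) \in behead (flat c a b d).
Proof.
by case: l1; case: l2; case: l3 => // _;
  rewrite /= ?addr0 ?add0r ?addrA !inE eqxx ?orbT.
Qed.

(** The three hypotheses are the parity checks of the Hamming code of length 7,
    whose words are the restrictions of affine functions to the nonzero points
    of a space of dimension 3. *)
Lemma hamming_affine (e0 e1 e2 e3 e4 e5 e6 : bool) :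
  e0 (+) e2 (+) e4 (+) e6 = false -> e1 (+) e2 (+) e5 (+) e6 = false ->
  e3 (+) e4 (+) e5 (+) e6 = false -> exists l0 la lb ld,
  [:: e0; e1; e2; e3; e4; e5; e6] = behead (affine8 l0 la lb ld) /\
  l0 = e0 (+) e1 (+) e2 (+) e3 (+) e4 (+) e5 (+) e6.
Proof.
move=> h1 h2 h3; pose l0 := e0 (+) e1 (+) e2 (+) e3 (+) e4 (+) e5 (+) e6.
exists l0, (e0 (+) l0), (e1 (+) l0), (e3 (+) l0); split=> //; move: h1 h2 h3.
by rewrite {}/l0; case: e0; case: e1; case: e2; case: e3; case: e4; case: e5; case: e6.
Qed.

Lemma twist_flat l0 la lb ld c a b d :
  twist (behead (affine8 l0 la lb ld)) (behead (flat c a b d)) =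
  behead (flat (c + bit l0 eps) (a + bit la eps) (b + bit lb eps) (d + bit ld eps)).
Proof.
rewrite /twist /flat [LHS]/= [RHS]/= !(bitD V2).
by congr [:: _; _; _; _; _; _; _]; char2 V2.
Qed.


(** The next lemmas evaluate characters on doubled lists: a character that takes
    the value true at u takes both values on each pair {x, x+u}. *)
Lemma count_doubled (P : pred V) u t :
  count P (doubled u t) = (count P t + count (fun x => P (x + u)%R) t)%N.
Proof. by rewrite count_cat count_map. Qed.

Lemma count_doubled_inv (P : pred V) u t : (forall x, P (x + u) = P x) ->
  count P (doubled u t) = (2 * count P t)%N.
Proof. by move=> PE; rewrite count_doubled (eq_count PE) mul2n addnn. Qed.

Lemma count_doubled_opp (P : pred V) u t : (forall x, P (x + u) = ~~ P x) ->
  count P (doubled u t) = size t.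
Proof. by move=> PE; rewrite count_doubled (eq_count PE) count_predC. Qed.

Lemma count_perm_doubled s a b t0 t1 r : perm_eq s (doubled a t0 ++ doubled b t1 ++ r) ->
  forall P, count P s = (count P (doubled a t0) + (count P (doubled b t1) + count P r))%N.
Proof.
move=> p P; rewrite (permP p).
exact: etrans (count_cat _ _ _) (congr1 _ (count_cat _ _ _)).
Qed.

(** Signing both points of a pair {x, x+a} gives a pair with difference a or
    a + eps, according to whether the two signs agree. *)
Lemma twist_doubled E1 E2 t a : size E1 = size t -> size E2 = size t ->
  exists t0 t1, (size t0 + size t1 = size t)%N /\
  perm_eq (twist E1 t ++ twist E2 [seq x + a | x <- t])
          (doubled a t0 ++ doubled (a + eps) t1).
Proof.
elim: t E1 E2 => [|x t IH] [|e1 E1] [|e2 E2] // => [_ _|[s1] [s2]].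
  by exists [::], [::].
have [t0 [t1 [st p]]] := IH _ _ s1 s2; pose y := x + bit e1 eps.
have Ey : x + a + bit e2 eps = y + a + bit (e1 (+) e2) eps.
  by rewrite /y (bitD V2); char2 V2.
case e12: (e1 (+) e2) Ey => Ey.
  exists t0, (y :: t1); split; first by rewrite /= -st addnS.
  apply/permP => P; have := permP p P.
  by rewrite /twist /doubled /= -/y Ey ?count_cat /= ?count_cat /= !addrA; count_lia.
exists (y :: t0), t1; split; first by rewrite /= -st addSn.
apply/permP => P; have := permP p P.
by rewrite /twist /doubled /= -/y Ey ?count_cat /= ?count_cat /= addr0; count_lia.
Qed.

(** If 4 = 0, then 2 [x] = - 2 [x] = 2 [x + eps]. *)
Lemma double_flip (A : zmodType) (h : V -> A) (k : bool) x : admissible h -> (k -> four0) ->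
  h x + h x = h (x + bit k eps) + h (x + bit k eps).
Proof.
move=> [hN h4]; case: k => [/(_ isT) fl|_]; last by rewrite addr0.
by rewrite /= hN -[RHS]add0r -(h4 fl x) !mulrS mulr0n addr0 !addrA addrK addrK.
Qed.

Lemma span2 chi a v : character chi -> chi eps -> chi a = false -> a != 0 ->
  (forall f, character f -> f eps = false -> f a = false -> f v = false) ->
  exists e, v = bit e a + bit (chi v) eps.
Proof.
move=> chiP chie ca a0 H; have [g gP ga] := character_separates V2 a0.
pose w := proj chi eps v.
have : proj g a w = 0.
  apply: (character_ext V2) => f fP; rewrite character0 //.
  apply: (H (fun x => f (proj g a (proj chi eps x)))) => [x y||].
  - by rewrite !projD.
  - by rewrite {2}/proj chie V2 /proj !character0.
  - by rewrite (proj_id _ ca) /proj ga V2 character0.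
case/(proj_eq0 V2 gP) => wE; [exists false | exists true];
  by rewrite /= -wE /w /proj; case: (chi v); rewrite /= ?add0r ?(addVK V2) ?V2 ?addr0 // /bit.
Qed.

Variable s : seq V.
Hypothesis s14 : size s = 14%N.
Hypothesis sI : in_I3 s.
Hypothesis s_aniso2 : forall x y r, perm_eq s [:: x, y & r] -> x + y != eps.
Hypothesis s_aniso3 : four0 -> forall x r, ~~ perm_eq s [:: x, x, x & r].


Lemma wsum_flat_behead (A : zmodType) (h : V -> A) c a b d :
  wsum h (flat c a b d) = h c + wsum h (behead (flat c a b d)).
Proof. exact: wsum_cons. Qed.

Lemma no_opposite_pair x y : x \in s -> y \in s -> x != y -> x + y != eps.
Proof.
move=> xs ys xy; apply: (s_aniso2 (r := rem y (rem x s))).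
rewrite (perm_trans (perm_to_rem xs)) // perm_cons perm_to_rem //.
by move: ys; rewrite (perm_mem (perm_to_rem xs)) inE eq_sym (negbTE xy).
Qed.

(** The common point of the two flats occurs twice in their union and contributes
    nothing, since [v] = - [v] when eps = 0. *)
Lemma pfister_sum_eps0 : eps = 0 -> pfister_sum s.
Proof.
move=> e0; have [o [m [p uo]]] := odd_part s.
have m0 : m = [::].
  case: m p => // x m p; have : x + x != eps.
    apply: (s_aniso2 (r := o ++ m ++ m)); apply: (perm_trans p).
    by apply/permP => P; rewrite /= !count_cat /= !count_cat /=; count_lia.
  by rewrite V2 e0 eqxx.
rewrite m0 !cats0 in p; have us : uniq s by rewrite (perm_uniq p).
have qs : quad_even s.
  split=> [|f g fP gP]; first by rewrite s14.
  by apply: I3_test_quadratic => //; rewrite e0 character0.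
have [c [a [b [d [a' [b' [d' [_ p']]]]]]]] := quad_even_size14 V2 us qs s14.
exists c, a, b, d, c, a', b', d' => A h [hN _].
rewrite (wsum_perm _ p') wsum_cat !wsum_flat_behead addrACA.
by have := hN c; rewrite e0 addr0 => {1}->; rewrite addNr add0r.
Qed.

(** A character chi with chi eps = true splits V as the sum of its kernel and of
    the group generated by eps; it is the sign of the elements of V. *)
Section Signed.
Variable chi : V -> bool.
Hypotheses (chiP : character chi) (chie : chi eps).

Let gam := proj chi eps.
Let gamD : {morph gam : x y / x + y} := projD V2 eps chiP.

Lemma eps_neq0 : eps != 0.
Proof. by apply/eqP => e; move: chie; rewrite e character0. Qed.

Lemma character_gam f : character f -> character (f \o gam).
Proof. by move=> fP x y; rewrite /= gamD. Qed.

Lemma gam_eps : gam eps = 0.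
Proof. by rewrite /gam /proj chie V2. Qed.

(** Anisotropy makes the reduction modulo eps injective on o, because it excludes
    opposite entries. *)
Lemma quad_even_odd_part o m : perm_eq s (o ++ m ++ m) -> uniq o ->
  uniq (map gam o) /\ quad_even (map gam o).
Proof.
move=> p uo; split.
  rewrite map_inj_in_uniq // => x y xo yo /(proj_inj V2)[//|xy].
  have xs : x \in s by rewrite (perm_mem p) mem_cat xo.
  have ys : y \in s by rewrite (perm_mem p) mem_cat yo.
  have nxy : x != y by rewrite xy addu_neq // eps_neq0.
  by have := no_opposite_pair xs ys nxy; rewrite xy addrAC V2 add0r eqxx.
have E f : ~~ odd (count f (map gam s)) -> ~~ odd (count f (map gam o)).
  rewrite !count_map (permP p) !count_cat addnn oddD odd_double addbF.
  by [].
split=> [|f g fP gP].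
  by rewrite -count_predT E // count_map count_predT s14.
apply: E; rewrite count_map.
by apply: (I3_test_quadratic sI (character_gam fP) (character_gam gP)); rewrite /= gam_eps character0.
Qed.

(** Size 0 is impossible: s would be twice a list m of 7 entries, whereas the
    test modulo 4 forces m to be of even size. *)
Lemma odd_part_size o m : perm_eq s (o ++ m ++ m) -> uniq o ->
  (size o + 2 * size m = 14)%N /\ [\/ size o = 14%N, size o = 12%N | size o = 8%N].
Proof.
move=> p uo; have [ug qg] := quad_even_odd_part p uo.
have e : (size o + 2 * size m = 14)%N.
  by rewrite -s14 (perm_size p) !size_cat mul2n addnn.
split=> //.
have := quad_even_size_neq2 V2 ug qg; have := quad_even_size_neq4 V2 ug qg.
have := quad_even_size_neq6 V2 ug qg; have := quad_even_size_neq10 V2 ug qg.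
rewrite !size_map => n10 n6 n4 n2.
have n0 : size o != 0%N.
  apply/eqP => o0; have m7 : size m = 7%N by move: e; rewrite o0; lia.
  have := I3_test_size_mod4 chiP chie sI.
  rewrite s14 (permP p) !count_cat (size0nil o0) /= => /dvdnP[k]; lia.
have : size o \in [:: 0; 2; 4; 6; 8; 10; 12; 14]%N.
  by move: e; rewrite !inE; clear; lia.
rewrite !inE (negbTE n0) (negbTE n2) (negbTE n4) (negbTE n6) (negbTE n10) /=.
by case/or3P => /eqP; [constructor 3 | constructor 2 | constructor 1].
Qed.

Lemma lift_signs o L : perm_eq (map gam o) L ->
  exists E, size E = size L /\ perm_eq o (twist E L).
Proof.
move=> /perm_map_lift[o' p <-]; exists (map chi o'); split; first by rewrite !size_map.
apply: (perm_trans p); rewrite (_ : twist _ _ = o') //.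
rewrite /twist; elim: (o') => //= x l ->; congr (_ :: _).
by rewrite /gam /proj; case: (chi x); rewrite /= ?(addVK V2) ?addr0.
Qed.

Lemma gam_in_ker o L : perm_eq (map gam o) L -> {in L, forall x, chi x = false}.
Proof.
by move=> p x; rewrite -(perm_mem p) => /mapP[y _ ->]; apply: proj_ker.
Qed.

(** A character f with f eps = true may be replaced by the sum of f and chi. *)
Lemma character_ext_eps z : chi z = false ->
  (forall f, character f -> f eps = false -> f z = false) -> z = 0.
Proof.
move=> cz H; apply: (character_ext V2) => f fP; rewrite character0 //.
case fe: (f eps); last exact: H.
have fP' : character (fun x => f x (+) chi x).
  by move=> x y; rewrite fP chiP addbACA.
by have := H _ fP'; rewrite fe chie cz addbF; apply.
Qed.

(** Modulo eps, the entries are the points other than c of two flats meeting only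
    in c.  The tests modulo 4 say that c plus the sum of the negative points is
    0 and that their number is odd.  As the directions of the two flats are
    independent, the signs satisfy the Hamming parity checks on each flat, so
    both flats can be signed; their signs at c are opposite. *)
Lemma pfister_sum_distinct : uniq (map gam s) -> pfister_sum s.
Proof.
move=> ug; have qg : quad_even (map gam s).
  by have [] := quad_even_odd_part (o := s) (m := [::]); rewrite ?cats0 //; apply: map_uniq ug.
have [|c [a [b [d [a' [b' [d' [uL p]]]]]]]] := quad_even_size14 V2 ug qg.
  by rewrite size_map.
have ker := gam_in_ker p; have [E [sE pE]] := lift_signs p.
have cc : chi c = false.
  have := ker (c + a); have := ker (c + b); have := ker (c + a + b).
  rewrite !chiP !inE !eqxx !orbT.
  by case: (chi c); case: (chi a); case: (chi b) => /= H1 H2 H3;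
    have := H1 isT; have := H2 isT; have := H3 isT.
have z0 : c + select E (behead (flat c a b d) ++ behead (flat c a' b' d')) = 0.
  apply: character_ext_eps => [|f fP fe].
    by rewrite chiP cc character_select // count_ker_zip.
  have := I3_test_mod4 chiP chie sI fP fe.
  rewrite !(permP pE) (count_twist fP fe sE) (count_twist_sign chiP chie fP fe sE ker) //.
  rewrite fP character_select // count_cat; apply: dvd4_parity.
    exact: (flat_count4 c a b d fP).
  exact: (flat_count4 c a' b' d' fP).
have oE : odd (count id E).
  have := I3_test_size_mod4 chiP chie sI.
  by rewrite s14 (permP pE) count_sign_twist // => /dvd4_14.
case: E sE pE z0 oE => [|e0 [|e1 [|e2 [|e3 [|e4 [|e5 [|e6 E']]]]]]] //.
case: E' => [|f0 [|f1 [|f2 [|f3 [|f4 [|f5 [|f6 []]]]]]]] // _ pE z0 oE.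
pose E1 := [:: e0; e1; e2; e3; e4; e5; e6]; pose E2 := [:: f0; f1; f2; f3; f4; f5; f6].
have {}pE : perm_eq s (twist E1 (behead (flat c a b d)) ++ twist E2 (behead (flat c a' b' d'))).
  by [].
have {}z0 : c + (select E1 (behead (flat c a b d)) + select E2 (behead (flat c a' b' d'))) = 0.
  by rewrite -z0 /select -big_cat -zip_cat.
rewrite !select_flat in z0.
set k1 := e0 (+) e1 (+) e2 (+) e3 (+) e4 (+) e5 (+) e6 in z0.
set k2 := f0 (+) f1 (+) f2 (+) f3 (+) f4 (+) f5 (+) f6 in z0.
have k12 : k2 = ~~ k1.
  move: oE; rewrite /k1 /k2 {z0 pE E1 E2 k1 k2} /=.
  have -> : (e0 + (e1 + (e2 + (e3 + (e4 + (e5 + (e6 + (f0 + (f1 + (f2 + (f3 + (f4 + (f5 + (f6 + 0)))))))))))))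
    = (e0 + e1 + e2 + e3 + e4 + e5 + e6) + (f0 + f1 + f2 + f3 + f4 + f5 + f6))%N.
    by rewrite addn0 !addnA.
  by rewrite !oddD !oddb => H; rewrite -[RHS]addbT -H addbA addbb.
move: z0.
set al := e0 (+) e2 (+) e4 (+) e6; set be := e1 (+) e2 (+) e5 (+) e6.
set de := e3 (+) e4 (+) e5 (+) e6.
set al' := f0 (+) f2 (+) f4 (+) f6; set be' := f1 (+) f2 (+) f5 (+) f6.
set de' := f3 (+) f4 (+) f5 (+) f6 => z0.
pose v := bit al a + bit be b + bit de d.
pose v' := bit al' a' + bit be' b' + bit de' d'.
(* v and v' are the parts of the relation z0 along the two flats; they are equal,
   and a nonzero one would give a second common point of the flats. *)
have vv : c + v = c + v'.
  congr (_ + _); apply: (sum_pair0 V2); rewrite -z0 k12 /v /v'.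
  by case: (k1); rewrite /= ?addr0 ?add0r; char2 V2.
have nB : [|| al, be | de] = false.
  apply/negP => ne; have := flat_dir_mem c a b d ne; rewrite -/v => vB.
  move: uL; rewrite cons_uniq cat_uniq => /andP[cL /and3P[_ /hasPn D _]].
  case nz': [|| al', be' | de'].
    have := flat_dir_mem c a' b' d' nz'; rewrite -/v' -vv => /D.
    by rewrite /= vB.
  move: vv nz'; rewrite /v'; case: (al') => //; case: (be') => //; case: (de') => // vv _.
  by move: cL; rewrite mem_cat -{1}[c]addr0 -{1}[0]addr0 -{1}[0]addr0 -vv vB.
have nB' : [|| al', be' | de'] = false.
  apply/negP => ne; have := flat_dir_mem c a' b' d' ne; rewrite -/v' -vv /v.
  move: nB; case: (al) => //; case: (be) => //; case: (de) => // _.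
  rewrite /= !addr0 => cB; move: uL; rewrite cons_uniq mem_cat cB orbT //.
move/norP: nB => [/negbTE a1 /norP[/negbTE a2 /negbTE a3]].
move/norP: nB' => [/negbTE a1' /norP[/negbTE a2' /negbTE a3']].
have [l0 [la [lb [ld [EE El]]]]] := hamming_affine a1 a2 a3.
have [l0' [la' [lb' [ld' [EE' El']]]]] := hamming_affine a1' a2' a3'.
move: pE; rewrite /E1 /E2 EE EE' !twist_flat => pE.
do 8!eexists; move=> A h [hN hfl]; rewrite (wsum_perm _ pE) wsum_cat !wsum_flat_behead.
rewrite addrACA -[LHS]add0r; congr (_ + _).
rewrite El El' -/k1 -/k2 k12.
by case: (k1); rewrite /= addr0 hN ?addNr ?addrN.
Qed.

End Signed.

(** Six pairs: those of t0 are multiples of <1,a>, those of t1 are multiples of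
    <1,-a>; the entry m occurs twice. *)
Section Twelve.
Variables (chi : V -> bool) (a m : V) (t0 t1 : seq V).
Hypotheses (chiP : character chi) (chie : chi eps) (ca : chi a = false) (a0 : a != 0).
Hypothesis ps : perm_eq s (doubled a t0 ++ doubled (a + eps) t1 ++ [:: m; m]).

(** Test characters that kill a and eps count each pair of t1 with both signs, so
    that only t0 and m contribute. *)
Lemma span_sum : exists e, \sum_(x <- t0) x + m =
  bit e a + bit (chi (\sum_(x <- t0) x + m)) eps.
Proof.
apply: span2 => // f fP fe fa.
have := I3_test_mod4 chiP chie sI fP fe.
have fae : f (a + eps) = false by rewrite fP fa fe.
have cae : chi (a + eps) by rewrite chiP ca chie.
rewrite !(count_perm_doubled ps).
rewrite [count f (doubled a _)]count_doubled_inv; last by move=> x; rewrite fP fa addbF.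
rewrite [count f (doubled (a + eps) _)]count_doubled_inv; last by move=> x; rewrite fP fae addbF.
rewrite [count _ (doubled a t0)]count_doubled_inv; last by move=> x; rewrite fP chiP fa ca !addbF.
rewrite [count _ (doubled (a + eps) t1)]count_doubled.
rewrite (@eq_count _ (fun x => f (x + (a + eps)) && _) (fun x => ~~ chi x && f x)); last first.
  by move=> x; rewrite fP chiP fae cae addbF addbT andbC.
rewrite (@eq_count _ (fun x => f x && chi x) (fun x => chi x && f x) _ t1); last by move=> x; rewrite andbC.
rewrite count_split [count f [:: m; m]]/= [count _ [:: m; m]]/= !addn0 !addnn -!mul2n.
by move/dvd4_span; rewrite fP character_sum.
Qed.

Lemma t1_odd : odd (size t1).
Proof.
have := I3_test_size_mod4 chiP chie sI.
rewrite s14 (count_perm_doubled ps).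
rewrite count_doubled_inv; last by move=> x; rewrite chiP ca addbF.
rewrite count_doubled_opp; last by move=> x; rewrite !chiP ca chie /= addbT.
by rewrite /= addn0 addnn -mul2n; apply: dvd4_sizes.
Qed.

(** The relation of [span_sum] gives m = x or m = x + a up to sign; the sign or the
    multiplicity of m then contradicts anisotropy. *)
Lemma t0_neq1 : size t0 = 1%N -> size t1 = 5%N -> False.
Proof.
move: span_sum ps; case: t0 => [|x [|? ?]] [e] E p //= _ s5.
move: E; rewrite big_cons big_nil addr0 => E.
pose y := x + bit e a.
have ys : exists r, perm_eq s [:: m, m, y & r].
  rewrite /y; case: (e); [exists (x :: doubled (a + eps) t1) | exists (x + a :: doubled (a + eps) t1)];
  apply: (perm_trans p); apply/permP => P; rewrite /doubled /= ?addr0 ?count_cat /= ?count_cat /=; count_lia.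
have mE : m = y + bit (chi (x + m)) eps.
  have -> : m = x + (x + m) by rewrite addrA V2 add0r.
  by rewrite {1}E addrA -/y [x + (x + m)]addrA V2 add0r.
have [r pr] := ys.
case c: (chi (x + m)) mE => mE.
  have : m + y != eps.
    apply: (s_aniso2 (r := m :: r)); apply: (perm_trans pr).
    by apply/permP => P /=; count_lia.
  by rewrite mE addrAC V2 add0r eqxx.
rewrite addr0 in mE; case: (EM four0) => [/s_aniso3 H|nfl].
  by have /negP := H m r; apply; rewrite {3}mE.
have := I3_test_mod8 chiP chie nfl sI; rewrite s14 (count_perm_doubled p).
rewrite count_doubled_inv; last by move=> z; rewrite chiP ca addbF.
rewrite count_doubled_opp; last by move=> z; rewrite !chiP ca chie /= addbT.
rewrite s5 /= !addn0 addnn -[(chi m).*2]mul2n => /dvd8_15.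
by move: c; rewrite chiP => ->.
Qed.

End Twelve.

(** Produces the second sign chi + f, for which a + eps is positive.  It makes the
    statements about t0 and a available for t1 and a + eps. *)
Lemma sign_switch chi a : character chi -> chi eps -> chi a = false -> a != 0 ->
  exists2 f, character f & [/\ f eps = false, f a &
    character (fun x => chi x (+) f x)].
Proof.
move=> chiP chie ca a0; have [g gP ga] := character_separates V2 a0.
have fP : character (g \o proj chi eps) by move=> x y; rewrite /= projD.
exists (g \o proj chi eps) => //; split.
- by rewrite /= /proj chie V2 character0.
- by rewrite /= proj_id.
- by move=> x y; rewrite chiP fP addbACA.
Qed.

Lemma count_xor f g t :
  (count (fun x => f x (+) g x) t +
   (count (fun x => g x && f x) t + count (fun x => ~~ g x && ~~ f x) t) = size t)%N.
Proof. by elim: t => //= x t <-; case: (f x); case: (g x) => /=; clear; lia. Qed.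

(** Both t0 and t1 have three elements.  By [span_sum], adding m to each of them
    gives four points with trivial sum modulo a, resp. a + eps, up to a sign.
    The test modulo 4 shows that the two signs are equal; the test modulo 8
    shows that they are positive unless 4 = 0, and in that case both are changed
    by replacing m with its opposite. *)
Lemma pfister_sum_twelve chi a m t0 t1 : character chi -> chi eps ->
  chi a = false -> a != 0 -> (size t0 + size t1 = 6)%N ->
  perm_eq s (doubled a t0 ++ doubled (a + eps) t1 ++ [:: m; m]) -> pfister_sum s.
Proof.
move=> chiP chie ca a0 st p.
have [f fP [fe fa chiP']] := sign_switch chiP chie ca a0.
set chi' := (fun x => _) in chiP'.
have chie' : chi' eps by rewrite /chi' chie fe.
have cae' : chi' (a + eps) = false by rewrite chiP' /chi' ca fa chie fe.
have ae0 : a + eps != 0.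
  by apply/eqP => /(sum_pair0 V2) ae; move: ca; rewrite ae chie.
have p' : perm_eq s (doubled (a + eps) t1 ++ doubled (a + eps + eps) t0 ++ [:: m; m]).
  by rewrite (addVK V2); apply: (perm_trans p); rewrite perm_catCA.
have o1 := t1_odd chiP chie ca p; have o0 := t1_odd chiP' chie' cae' p'.
have [e E] := span_sum chiP chie ca a0 p.
have [e' E'] := span_sum chiP' chie' cae' ae0 p'.
have n1 : size t0 != 1%N.
  apply/eqP => s1; apply: (t0_neq1 chiP chie ca a0 p s1).
  by move: st; rewrite s1; clear; lia.
have n1' : size t1 != 1%N.
  apply/eqP => s1; apply: (t0_neq1 chiP' chie' cae' ae0 p' s1).
  by move: st; rewrite s1; clear; lia.
have s03 : size t0 = 3%N by move: st o0 o1 n1 n1'; clear; lia.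
have s13 : size t1 = 3%N by move: st s03; clear; lia.
have par : f m (+) odd (count chi t0) (+) odd (count chi' t1) = false.
  have := I3_test_mod4 chiP chie sI fP fe; rewrite !(count_perm_doubled p).
  rewrite [count f (doubled a _)]count_doubled_opp; last by move=> x; rewrite fP fa addbT.
  rewrite [count f (doubled (a + eps) _)]count_doubled_opp; last first.
    by move=> x; rewrite !fP fa fe /= addbT.
  rewrite [count _ (doubled a t0)]count_doubled [count _ (doubled (a + eps) t1)]count_doubled.
  rewrite (@eq_count _ (fun x => f (x + a) && _) (fun x => ~~ f x && chi x)); last first.
    by move=> x; rewrite fP chiP fa ca addbF addbT.
  rewrite count_split.
  rewrite (@eq_count _ (fun x => f (x + (a + eps)) && _) (fun x => ~~ f x && ~~ chi x)); last first.
    by move=> x; rewrite !fP !chiP fa fe ca chie; case: (f x); case: (chi x).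
  rewrite s03 s13 [count f [:: m; m]]/= [count _ [:: m; m]]/= !addn0 ![(nat_of_bool _ + _)%N]addnn -!mul2n.
  by apply: dvd4_33; rewrite -s13; apply: count_xor.
have sg : ~ four0 -> chi (\sum_(x <- t0) x + m) = false.
  move=> nfl; have := I3_test_mod8 chiP chie nfl sI; rewrite s14 (count_perm_doubled p).
  rewrite count_doubled_inv; last by move=> z; rewrite chiP ca addbF.
  rewrite count_doubled_opp; last by move=> z; rewrite !chiP ca chie /= addbT.
  rewrite s13 [count _ [:: m; m]]/= !addn0 addnn -[(chi m).*2]mul2n => /dvd8_33.
  by rewrite chiP character_sum.
have E2 : chi' (\sum_(x <- t1) x + m) = chi (\sum_(x <- t0) x + m).
  rewrite chiP' (character_sum _ chiP') chiP (character_sum _ chiP) {2}/chi'.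
  by move: par; case: (f m); case: (chi m); case: (odd (count chi t0)); case: (odd (count chi' t1)).
set k := chi (\sum_(x <- t0) x + m) in E E2 sg.
rewrite E2 in E'.
pose m' := m + bit k eps.
have hm (A : zmodType) (h : V -> A) : admissible h -> h m + h m = h m' + h m'.
  move=> hh; apply: double_flip => // kT; apply: contrapT => /sg.
  by rewrite -/k kT.
have Em : \sum_(x <- t0) x + m' = bit e a by rewrite addrA E (addVK V2).
have Em' : \sum_(x <- t1) x + m' = bit e' (a + eps) by rewrite addrA E' (addVK V2).
clearbody m'; clear E E' E2 sg k.
clear p' o1 o0 st par n1 n1'.
case: t0 s03 Em p => [|x [|y [|z []]]] // _ Em p.
case: t1 s13 Em' p => [|x1 [|y1 [|z1 []]]] // _ Em' p.
have Q : x + y + z + m' = 0 \/ x + y + z + m' = a.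
  move: Em; rewrite !big_cons big_nil addr0 !addrA => ->.
  by case: (e); [right | left].
have Q' : x1 + y1 + z1 + m' = 0 \/ x1 + y1 + z1 + m' = a + eps.
  move: Em'; rewrite !big_cons big_nil addr0 !addrA => ->.
  by case: (e'); [right | left].
have pQ := doubled4_flat V2 Q; have pQ' := doubled4_flat V2 Q'.
exists x, (x + y), (x + z), a, x1, (x1 + y1), (x1 + z1), (a + eps) => A h hh.
have E (u : V) v1 v2 v3 : wsum h (doubled u [:: v1; v2; v3; m']) =
    wsum h (doubled u [:: v1; v2; v3]) + (h m' + h (m' + u)).
  rewrite /doubled !wsum_cat addrACA; congr (_ + _);
  by rewrite /= !wsum_cons /wsum big_nil !addr0 !addrA.
rewrite (wsum_perm _ p) -(wsum_perm _ pQ) -(wsum_perm _ pQ') !E addrACA.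
have -> : h (m' + (a + eps)) = - h (m' + a) by rewrite addrA hh.1.
rewrite [X in _ = _ + X]addrACA subrr addr0 -(hm _ _ hh) !(wsum_cat _ (doubled _ _)).
by rewrite addrA; congr (_ + _); rewrite !wsum_cons [wsum h [::]]big_nil addr0.
Qed.

(** After lifting the flat one entry t has the wrong sign, which contributes twice
    t + eps.  The points t + eps and m have sum 0, up to a sign dealt with by
    [double_flip], so that their double is a flat with one direction equal to 0. *)
Lemma pfister_sum_eight chi o m : character chi -> chi eps ->
  uniq (map (proj chi eps) o) -> quad_even (map (proj chi eps) o) ->
  size o = 8%N -> size m = 3%N -> perm_eq s (o ++ m ++ m) -> pfister_sum s.
Proof.
move=> chiP chie uo qo o8 m3 p.
have cs P : count P s = (count P o + (count P m + count P m))%N.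
  rewrite (permP p); exact: etrans (count_cat _ _ _) (congr1 _ (count_cat _ _ _)).
have [|c0 [a0 [b0 [d0 pr]]]] := quad_even_size8 V2 uo qo; first by rewrite size_map.
have uf : uniq (flat c0 a0 b0 d0) by rewrite -(perm_uniq pr).
have [c [a [b [d [T [T2 _ _ pT]]]]]] := flat_lift V2 chiP chie uf pr.
have cT P : (count P o + count P T = count P (flat c a b d) + count (fun x => P (x + eps)%R) T)%N.
  by rewrite -count_cat (permP pT) count_cat count_map.
have T1 : size T = 1%N.
  suff : odd (size T) by move: T2; case: (size T) => [|[|[]]].
  rewrite -(count_predC chi T); apply: (dvd4_lift_size (co := count chi o) (cm := count chi m)
    (cF := count chi (flat c a b d))).
  - by rewrite -cs -s14; apply: I3_test_size_mod4.
  - exact: flat_count4.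
  - by rewrite cT; congr (_ + _)%N; apply: eq_count => x; rewrite /= chiP chie addbT.
case: T T1 {T2} pT cT => [|t []] // _ pT cT.
have {}cT P : (count P o + P t = count P (flat c a b d) + P (t + eps)%R)%N.
  by have := cT P; rewrite ![count _ [:: t]]/= !addn0.
pose Z := t + eps + \sum_(x <- m) x.
have fZ f : character f -> f eps = false -> f Z = false.
  move=> fP fe; rewrite /Z !fP fe addbF character_sum //.
  have := I3_test_mod4 chiP chie sI fP fe; rewrite !cs => /dvd4_lift.
  have cf : count f o = count f (flat c a b d).
    by have := cT f; rewrite fP fe addbF => /addIn.
  move/(_ (f t) (chi t) (count (fun x => f x && chi x) (flat c a b d))); apply.
  - by rewrite cf; apply: flat_count4.
  - by have [_ ->] := quad_even_flat c a b d.
  - by have := cT (fun x => f x && chi x); rewrite fP chiP fe chie addbF addbT.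
have sg : ~ four0 -> chi Z = false.
  move=> nfl; have := I3_test_mod8 chiP chie nfl sI; rewrite s14 cs => /dvd8_lift.
  move/(_ (chi t) _ (flat_count4 c a b d chiP)) => H.
  rewrite /Z !chiP chie character_sum //; apply: H.
  by have := cT chi; rewrite chiP chie addbT.
have ZE : Z + bit (chi Z) eps = 0.
  apply: (character_ext_eps chiP chie).
    by rewrite chiP; case E: (chi Z); rewrite /= ?chie ?character0.
  by move=> f fP fe; rewrite fP fZ //; case: (chi Z); rewrite /= ?fe ?character0.
case: m m3 p cs @Z fZ sg ZE => [|m1 [|m2 [|m3 []]]] // _ p _ Z _ sg ZE.
have fl : chi Z -> four0 by move=> kT; apply: contrapT => /sg; rewrite kT.
pose m1' := m1 + bit (chi Z) eps.
have Q : t + eps + m1' + m2 + m3 = 0.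
  rewrite -ZE /m1'; move: (bit (chi Z) eps) => w.
  by rewrite /Z !big_cons big_nil addr0; char2 V2.
have pQ := doubled4_flat V2 (or_introl _ Q : t + eps + m1' + m2 + m3 = 0 \/ _ = 0).
exists c, a, b, d, (t + eps), (t + eps + m1'), (t + eps + m2), 0 => A h hh.
have ho : wsum h o = wsum h (flat c a b d) + (h (t + eps) + h (t + eps)).
  have := wsum_perm h pT; rewrite wsum_cat (wsum_cat _ (flat _ _ _ _)) [map _ _]/=.
  rewrite !(wsum_cons _ _ [::]) [wsum h [::]]big_nil !addr0 hh.1.
  by move/(canRL (addrK _)) => ->; rewrite addrA.
have dE (x : V) : x + 0 = x by rewrite addr0.
rewrite -(wsum_perm _ pQ) (wsum_perm _ p) /doubled !wsum_cat ho -addrA; congr (_ + _).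
rewrite (eq_map dE) map_id !wsum_cons [wsum h [::]]big_nil !addr0.
have H := double_flip m1 hh fl; rewrite -/m1' in H.
by rewrite (addrACA (h m1)) H (addrACA (h m1') (h m1')) (addrACA (h (t + eps))).
Qed.

(** The combinatorial form of the result.  The two anisotropy hypotheses exclude
    opposite entries, and triple entries when 4 = 0, as then 3 [v] = - [v]. *)
Theorem two_flats : pfister_sum s.
Proof.
have [/pfister_sum_eps0//|e0] := eqVneq eps 0.
have [chi chiP chie] := character_separates V2 e0.
have [o [m [p uo]]] := odd_part s.
have [ug qg] := quad_even_odd_part chiP chie p uo.
have [sz [o14|o12|o8]] := odd_part_size chiP chie p uo.
- apply: (pfister_sum_distinct chiP chie).
  have m0 : m = [::] by apply: size0nil; move: sz; rewrite o14; clear; lia.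
  by move: p; rewrite m0 !cats0 => /(perm_map (proj chi eps))/perm_uniq ->.
- have m1 : size m = 1%N by move: sz; rewrite o12; clear; lia.
  case: m m1 p {sz} => [|m []] // _ p.
  have [|a [t [a0 pt]]] := quad_even_size12 V2 ug qg; first by rewrite size_map.
  have ker := gam_in_ker chiP chie pt; have [E [sE pE]] := lift_signs pt.
  have t6 : size t = 6%N.
    by have := size_split (r := [::]) (s := map (proj chi eps) o) (u := a) (t := t);
      rewrite cats0 size_map o12 /= => /(_ pt); clear; lia.
  have ca : chi a = false.
    case: t t6 ker {pt sE pE} => // x t _ ker.
    have := ker x; have := ker (x + a); rewrite chiP /doubled !mem_cat mem_head.
    by rewrite !inE eqxx !orbT => /(_ isT) + /(_ isT) => /[swap] ->.
  have sE2 : size E = (size t + size t)%N by rewrite sE size_doubled mul2n addnn.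
  have [||t0 [t1 [st p1]]] := @twist_doubled (take (size t) E) (drop (size t) E) t a.
  - by rewrite size_takel // sE2 leq_addr.
  - by rewrite size_drop sE2 addnK.
  apply: (pfister_sum_twelve chiP chie ca a0 (t0 := t0) (t1 := t1) (m := m)); first by rewrite st.
  apply: (perm_trans p); rewrite [X in perm_eq _ X]catA (perm_cat2r [:: m; m]).
  apply: (perm_trans pE); rewrite -(cat_take_drop (size t) E) /twist zip_cat ?map_cat //.
  by rewrite size_takel // sE2 leq_addr.
- have m3 : size m = 3%N by move: sz; rewrite o8; clear; lia.
  exact: (pfister_sum_eight chiP chie ug qg o8 m3 p).
Qed.

End Witt.

(** * The group of square classes *)

Section SquareClasses.
Variable F : fieldType.
Implicit Types x y z : F.

Lemma same_square_class_refl x : same_square_class x x.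
Proof. by exists 1; rewrite ?oner_neq0 // expr1n mulr1. Qed.

Lemma same_square_class_sym x y : same_square_class x y -> same_square_class y x.
Proof.
case=> z z0 ->; exists z^-1; rewrite ?invr_eq0 //.
by rewrite exprVn mulfK // expf_neq0.
Qed.

Lemma same_square_class_trans x y z :
  same_square_class x y -> same_square_class y z -> same_square_class x z.
Proof.
case=> t t0 -> [w w0 ->]; exists (w * t); first exact: mulf_neq0.
by rewrite exprMn [in RHS]mulrA.
Qed.

(** A choice function applied to the square class of x depends only on that class;
    its fixed points represent the square classes. *)
Definition rep x := choose (fun y => `[< same_square_class x y >]) x.

Lemma repP x : same_square_class x (rep x).
Proof.
have xx : `[< same_square_class x x >] by exact/asboolP/same_square_class_refl.
exact/asboolP/(chooseP (P := fun y => `[< same_square_class x y >]) xx).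
Qed.

Lemma rep_eq x y : (rep x = rep y) <-> same_square_class x y.
Proof.
split=> [e|xy].
  apply: same_square_class_trans (repP x) _; rewrite e.
  exact/same_square_class_sym/repP.
rewrite /rep; have yx := same_square_class_sym xy.
rewrite (@eq_choose _ _ (fun z => `[< same_square_class y z >])); last first.
  by move=> z; apply/asboolP/asboolP; apply: same_square_class_trans.
by apply: choose_id; apply/asboolP => //; apply: same_square_class_refl.
Qed.

Lemma same_square_class_neq0 x y : same_square_class x y -> x != 0 -> y != 0.
Proof. by case=> z _ ->; rewrite mulf_eq0 negb_or => /andP[]. Qed.

Lemma rep_neq0 x : x != 0 -> rep x != 0.
Proof. exact: same_square_class_neq0 (repP x). Qed.

Lemma repK x : rep (rep x) = rep x.
Proof. exact/esym/rep_eq/repP. Qed.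

Definition sqclass := {x : F | (x != 0) && (rep x == x)}.
HB.instance Definition _ := Choice.on sqclass.

Fact sqclass_subproof x : (rep (if x == 0 then 1 else x) != 0) &&
  (rep (rep (if x == 0 then 1 else x)) == rep (if x == 0 then 1 else x)).
Proof.
rewrite repK eqxx andbT; apply: rep_neq0.
by have [_|//] := eqVneq x 0; rewrite oner_neq0.
Qed.

(** At 0 the default value is the class of 1. *)
Definition sqcl x : sqclass := 
  exist (fun y => is_true ((y != 0) && (rep y == y))) _ (sqclass_subproof x).

Definition sqcl_repr (v : sqclass) : F := sval v.

Lemma sqcl_repr_neq0 v : sqcl_repr v != 0.
Proof. by case: v => x /= /andP[]. Qed.

Lemma sqcl_eq x y : x != 0 -> y != 0 -> (sqcl x = sqcl y) <-> same_square_class x y.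
Proof.
move=> x0 y0; rewrite -rep_eq; split=> [/(congr1 sqcl_repr)|e].
  by rewrite /= (negbTE x0) (negbTE y0).
by apply: val_inj; rewrite /= (negbTE x0) (negbTE y0).
Qed.

Lemma sqcl_reprK v : sqcl (sqcl_repr v) = v.
Proof.
apply: val_inj; rewrite /= (negbTE (sqcl_repr_neq0 v)).
by case: v => x /= /andP[_ /eqP].
Qed.

Lemma same_square_classM x y z : same_square_class x y ->
  same_square_class (x * z) (y * z).
Proof. by case=> t t0 ->; exists t => //; rewrite mulrAC. Qed.

Lemma sqcl_repr_sqcl x : x != 0 -> same_square_class (sqcl_repr (sqcl x)) x.
Proof. by move=> x0; rewrite -sqcl_eq ?sqcl_repr_neq0 // sqcl_reprK. Qed.

Definition sqcl_add v w := sqcl (sqcl_repr v * sqcl_repr w).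

Lemma sqcl_add_sqcl x y : x != 0 -> y != 0 -> sqcl_add (sqcl x) (sqcl y) = sqcl (x * y).
Proof.
move=> x0 y0; apply/sqcl_eq; rewrite ?mulf_neq0 ?sqcl_repr_neq0 //.
apply: same_square_class_trans (same_square_classM _ (sqcl_repr_sqcl x0)) _.
by rewrite [_ * sqcl_repr _]mulrC [x * y]mulrC; apply/same_square_classM/sqcl_repr_sqcl.
Qed.

Fact sqcl_addC : commutative sqcl_add.
Proof. by move=> v w; rewrite /sqcl_add mulrC. Qed.

Fact sqcl_addA : associative sqcl_add.
Proof.
move=> u v w; rewrite -[u]sqcl_reprK -[v]sqcl_reprK -[w]sqcl_reprK.
by rewrite !sqcl_add_sqcl ?mulf_neq0 ?sqcl_repr_neq0 // mulrA.
Qed.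

Fact sqcl_add0 : left_id (sqcl 1) sqcl_add.
Proof.
by move=> v; rewrite -[v]sqcl_reprK sqcl_add_sqcl ?mul1r ?oner_neq0 ?sqcl_repr_neq0.
Qed.

Fact sqcl_addN : left_inverse (sqcl 1) id sqcl_add.
Proof.
move=> v; apply/sqcl_eq; rewrite ?mulf_neq0 ?sqcl_repr_neq0 ?oner_neq0 //.
by exists (sqcl_repr v); rewrite ?sqcl_repr_neq0 // mul1r expr2.
Qed.

HB.instance Definition _ := GRing.isZmodule.Build sqclass sqcl_addA sqcl_addC sqcl_add0 sqcl_addN.

Lemma sqclM x y : x != 0 -> y != 0 -> sqcl (x * y) = sqcl x + sqcl y.
Proof. by move=> x0 y0; rewrite -sqcl_add_sqcl. Qed.

Lemma sqclass2 (v : sqclass) : v + v = 0.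
Proof. exact: sqcl_addN. Qed.

Lemma sqclMsqr x y : x != 0 -> y != 0 -> sqcl (x * y ^+ 2) = sqcl x.
Proof. by move=> x0 y0; apply/sqcl_eq; rewrite ?mulf_neq0 ?expf_neq0 //; exists y. Qed.

Lemma sqclN x : x != 0 -> sqcl (- x) = sqcl x + sqcl (-1).
Proof. by move=> x0; rewrite -sqclM ?oppr_eq0 ?oner_neq0 // mulrN1. Qed.

End SquareClasses.

(** * Congruence of symmetric matrices *)

Section Congruence.
Variable F : fieldType.

(** Isometry in matrix form.  The two matrices may have sizes that are equal only
    up to a proof; the two-sided inverse P' avoids casts. *)
Definition congruent m n (A : 'M[F]_m) (B : 'M[F]_n) :=
  exists (P : 'M[F]_(m, n)) (P' : 'M[F]_(n, m)),
    [/\ P *m P' = 1%:M, P' *m P = 1%:M & P *m B *m P^T = A].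

Lemma congruent_refl m (A : 'M_m) : congruent A A.
Proof. by exists 1%:M, 1%:M; rewrite trmx1 !mulmx1 !mul1mx. Qed.

Lemma congruent_sym m n (A : 'M_m) (B : 'M_n) : congruent A B -> congruent B A.
Proof.
case=> P [P' [PP' P'P <-]]; exists P', P; split=> //.
rewrite !mulmxA P'P mul1mx -mulmxA -trmx_mul P'P trmx1 mulmx1 //.
Qed.

Lemma congruent_trans m n p (A : 'M_m) (B : 'M_n) (C : 'M_p) :
  congruent A B -> congruent B C -> congruent A C.
Proof.
case=> P [P' [PP' P'P <-]] [Q [Q' [QQ' Q'Q <-]]]; exists (P *m Q), (Q' *m P'); split.
- by rewrite mulmxA -(mulmxA P) QQ' mulmx1.
- by rewrite mulmxA -(mulmxA Q') P'P mulmx1.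
- by rewrite trmx_mul !mulmxA.
Qed.

Lemma congruent_block m1 n1 m2 n2 (A1 : 'M_m1) (B1 : 'M_n1) (A2 : 'M_m2) (B2 : 'M_n2) :
  congruent A1 B1 -> congruent A2 B2 ->
  congruent (block_mx A1 0 0 A2) (block_mx B1 0 0 B2).
Proof.
case=> P [P' [PP' P'P <-]] [Q [Q' [QQ' Q'Q <-]]].
exists (block_mx P 0 0 Q), (block_mx P' 0 0 Q').
split; rewrite ?tr_block_mx ?trmx0 !mulmx_block ?(mulmx0, mul0mx, addr0, add0r).
- by rewrite PP' QQ' -scalar_mx_block.
- by rewrite P'P Q'Q -scalar_mx_block.
- by [].
Qed.

Lemma tens1mx1 m n : (1%:M : 'M[F]_m) *t (1%:M : 'M[F]_n) = 1%:M.
Proof.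
apply/matrixP => i j; case: (mxtens_indexP i) => i1 i2; case: (mxtens_indexP j) => j1 j2.
rewrite tensmxE !mxE -natrM mulnb (inj_eq (can_inj (@mxtens_indexK _ _))).
by rewrite xpair_eqE.
Qed.

Lemma congruent_tens m1 n1 m2 n2 (A1 : 'M_m1) (B1 : 'M_n1) (A2 : 'M_m2) (B2 : 'M_n2) :
  congruent A1 B1 -> congruent A2 B2 -> congruent (A1 *t A2) (B1 *t B2).
Proof.
case=> P [P' [PP' P'P <-]] [Q [Q' [QQ' Q'Q <-]]]; exists (P *t Q), (P' *t Q').
by split; rewrite ?trmx_tens !tensmx_mul ?PP' ?P'P ?QQ' ?Q'Q ?tens1mx1.
Qed.

Lemma congruent_scale c m n (A : 'M_m) (B : 'M_n) : congruent A B ->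
  congruent (c *: A) (c *: B).
Proof.
case=> P [P' [PP' P'P <-]]; exists P, P'.
by rewrite -scalemxAr -scalemxAl.
Qed.

Lemma congruent_unit m n (A : 'M_m) (B : 'M_n) : congruent A B ->
  A \in unitmx -> B \in unitmx.
Proof.
move/congruent_sym => -[P [P' [PP' P'P <-]]] uA.
have : (P *m A *m P^T) *m (P'^T *m invmx A *m P') = 1%:M.
  rewrite !mulmxA -[_ *m P^T *m P'^T]mulmxA -trmx_mul P'P trmx1 mulmx1.
  by rewrite -[P *m A *m invmx A]mulmxA mulmxV // mulmx1.
by case/mulmx1_unit.
Qed.

Definition anisotropic_mx m (A : 'M[F]_m) :=
  forall v : 'rV_m, (v *m A *m v^T) 0 0 = 0 -> v = 0.

Lemma congruent_anisotropic m n (A : 'M_m) (B : 'M_n) : congruent A B ->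
  anisotropic_mx A -> anisotropic_mx B.
Proof.
move/congruent_sym => -[P [P' [PP' P'P <-]]] anA v.
rewrite !mulmxA -[_ *m P^T *m _]mulmxA -trmx_mul => /anA vP.
by rewrite -[v]mulmx1 -PP' mulmxA vP mul0mx.
Qed.

Hypothesis F2 : (2 : F) != 0.

Lemma mx_entry_form m n (A : 'M[F]_(m, n)) i j :
  (delta_mx 0 i *m A *m (delta_mx 0 j)^T : 'M_1) 0 0 = A i j.
Proof. by rewrite trmx_delta -rowE -colE !mxE. Qed.

Lemma quadratic_eq0 m (A : 'M[F]_m) : A^T = A ->
  (forall v : 'rV_m, (v *m A *m v^T) 0 0 = 0) -> A = 0.
Proof.
move=> sA A0; apply/matrixP => i j; rewrite mxE.
have Aii k : A k k = 0 by rewrite -mx_entry_form A0.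
have := A0 (delta_mx 0 i + delta_mx 0 j).
have mxD (X Y : 'M[F]_1) : (X + Y) 0 0 = X 0 0 + Y 0 0 by rewrite mxE.
rewrite linearD /= !(mulmxDl, mulmxDr) !mxD !mx_entry_form !Aii add0r addr0.
rewrite -{2}sA mxE => /eqP.
by rewrite -mulr2n -mulr_natl mulf_eq0 (negbTE F2) => /eqP.
Qed.


Lemma congruent_conj m (Q A : 'M[F]_m) : Q \in unitmx -> congruent A (Q *m A *m Q^T).
Proof.
by move=> uQ; apply: congruent_sym; exists Q, (invmx Q); rewrite mulmxV // mulVmx.
Qed.

(** The row space of v is completed to a basis by Gaussian elimination. *)
Lemma pivot n (A : 'M[F]_n.+1) (v : 'rV_n.+1) : (v *m A *m v^T) 0 0 != 0 ->
  exists2 Q, Q \in unitmx & (Q *m A *m Q^T) 0 0 != 0.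
Proof.
move=> c0; have v0 : v != 0 by apply: contraNneq c0 => ->; rewrite !mul0mx mxE.
have [k] : exists k, v = k *: (delta_mx 0 0 *m row_ebase v).
  exists (col_ebase v 0 0); rewrite -[LHS]mulmx_ebase rank_rV v0.
  rewrite [col_ebase v in LHS]mx11_scalar mul_scalar_mx -scalemxAl.
  congr (_ *: (_ *m _)); apply/matrixP => i j.
  by rewrite !mxE [i]ord1 eqxx /= andbT eq_sym.
move: (row_ebase v) (row_ebase_unit v) c0 => Q uQ c0 vE; exists Q => //.
apply: contraNneq c0 => QAQ; rewrite vE linearZ /= trmx_mul.
rewrite -!scalemxAl -!scalemxAr 2!mxE.
have := mx_entry_form (Q *m A *m Q^T) 0 0; rewrite QAQ !mulmxA => ->.
by rewrite !mulr0.
Qed.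

Lemma diagonalize n (A : 'M[F]_n) : A^T = A -> exists d : 'rV_n, congruent A (diag_mx d).
Proof.
elim: n A => [|n IH] A sA.
  by exists 0; rewrite [A]flatmx0 [diag_mx _]flatmx0; apply: congruent_refl.
case: (EM (forall v : 'rV_n.+1, (v *m A *m v^T) 0 0 = 0)) => [A0|nA0].
  by exists 0; rewrite (quadratic_eq0 sA A0) raddf0; apply: congruent_refl.
have [v /eqP/pivot[Q uQ]] : exists v : 'rV_n.+1, (v *m A *m v^T) 0 0 <> 0.
  by apply: contrapT => nex; apply: nA0 => v; apply: contrapT => nv; apply: nex; exists v.
set B : 'M_(1 + n) := Q *m A *m Q^T => B0.
have sB : B^T = B by rewrite /B !trmx_mul trmxK sA mulmxA.
pose a := B 0 0; pose b := ursubmx B.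
have Ba : ulsubmx B = a%:M.
  rewrite [ulsubmx B]mx11_scalar; congr (_%:M); rewrite 2!mxE.
  by congr (B _ _); apply: val_inj.
have Bb : dlsubmx B = b^T by rewrite /b trmx_ursub sB.
pose R : 'M_(1 + n) := block_mx 1%:M 0 (- a^-1 *: b^T) 1%:M.
have uR : R \in unitmx by rewrite unitmxE det_lblock !det1 mulr1 unitr1.
pose D := drsubmx B - a^-1 *: (b^T *m b).
have RBR : R *m B *m R^T = block_mx a%:M 0 0 D.
  rewrite -[B]submxK Ba Bb -/b /R tr_block_mx !mulmx_block !trmx1 !trmx0.
  rewrite !(mul1mx, mulmx1, mul0mx, mulmx0, addr0, add0r).
  have e1 : - a^-1 *: b^T *m a%:M + b^T = 0.
    by rewrite mul_mx_scalar scalerA mulrN divff // scaleN1r addNr.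
  rewrite e1 !mul0mx add0r linearZ /= trmxK mul_scalar_mx scalerA mulrN divff //.
  by rewrite scaleN1r addNr -scalemxAl scaleNr addrC.
have sD : D^T = D.
  by rewrite /D linearB linearZ /= trmx_mul trmxK trmx_drsub sB.
have [d cd] := IH D sD; exists (row_mx a%:M d).
apply: congruent_trans (congruent_conj _ uQ) _.
apply: congruent_trans (congruent_conj _ uR) _.
rewrite -/B RBR.
suff : congruent (block_mx (a%:M : 'M_1) 0 0 D) (block_mx (diag_mx (a%:M : 'rV_1)) 0 0 (diag_mx d)).
  by rewrite -diag_mx_row.
apply: congruent_block => //.
rewrite (_ : diag_mx _ = a%:M); first exact: congruent_refl.
by apply/matrixP => i j; rewrite !mxE [i]ord1 [j]ord1 eqxx !mulr1n.
Qed.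

(** If v and e have the same nonzero value, then one of v - e and v + e is not
    isotropic, because their values add up to four times that of e; the reflection
    in that vector maps v to e or to - e. *)
Lemma reflection_fix n (G : 'M[F]_n) (v e : 'rV_n) : G^T = G ->
  (v *m G *m v^T) 0 0 = (e *m G *m e^T) 0 0 -> (e *m G *m e^T) 0 0 != 0 ->
  exists2 R : 'M_n, [/\ R *m R = 1%:M & R *m G *m R^T = G] & v *m R = e \/ v *m R = - e.
Proof.
move=> sG qve qe0.
pose b (x y : 'rV_n) : F := (x *m G *m y^T) 0 0.
have bC x y : b x y = b y x.
  have E : (x *m G *m y^T)^T = y *m G *m x^T by rewrite !trmx_mul trmxK sG mulmxA.
  by rewrite /b -E [in RHS]mxE.
have bE (x y : 'rV_n) : x *m G *m y^T = (b x y)%:M by rewrite [LHS]mx11_scalar.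
have bDl x y z : b (x + y) z = b x z + b y z by rewrite /b !mulmxDl mxE.
have bNl x z : b (- x) z = - b x z by rewrite /b !mulNmx mxE.
have bDr x y z : b z (x + y) = b z x + b z y by rewrite bC bDl !(bC z).
have bZl c x z : b (c *: x) z = c * b x z by rewrite /b -!scalemxAl mxE.
have bZr c x z : b z (c *: x) = c * b z x by rewrite bC bZl (bC z).
have bNr x z : b z (- x) = - b z x by rewrite bC bNl (bC z).
have [s [w [s2 wE w0]]] : exists s w, [/\ s * s = 1 :> F, w = v - s *: e & b w w != 0].
  have [bm|bm] := eqVneq (b (v - e) (v - e)) 0; last first.
    by exists 1, (v - e); rewrite mulr1 scale1r.
  exists (-1), (v + e); split; rewrite ?mulrNN ?mulr1 ?scaleN1r ?opprK //.
  have : b (v + e) (v + e) + b (v - e) (v - e) = 2 * 2 * b e e.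
    rewrite !(bDl, bDr, bNl, bNr) [b e v]bC [b v v]qve -/(b e e); ring.
  by rewrite bm addr0 => ->; rewrite !mulf_neq0.
pose k := 2 / b w w; have kw : k * b w w = 2 by rewrite /k divfK.
pose S := G *m w^T *m w; pose R := 1%:M - k *: S.
have SS : S *m S = b w w *: S.
  rewrite /S !mulmxA -[_ *m w *m G]mulmxA -[_ *m (w *m G) *m _]mulmxA bE.
  by rewrite mul_mx_scalar -scalemxAl.
have RR : R *m R = 1%:M.
  have kSkS : (k *: S) *m (k *: S) = k *: S + k *: S.
    rewrite -scalemxAl -scalemxAr SS !scalerA -scalerDl; congr (_ *: _).
    by rewrite -mulrA kw mulr_natr mulr2n.
  by rewrite /R mulmxBr mulmx1 mulmxBl mul1mx kSkS opprB addrK subrK.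
have GR : G *m R^T = R *m G.
  rewrite /R linearB linearZ /= trmx1 mulmxBr mulmxBl mulmx1 mul1mx.
  rewrite -scalemxAr -scalemxAl; congr (_ - _ *: _).
  by rewrite /S !trmx_mul trmxK sG !mulmxA.
exists R; first by split=> //; rewrite -mulmxA GR mulmxA RR mul1mx.
have bvw : 2 * b v w = b w w.
  have bvv : b v v = b e e by [].
  rewrite wE !(bDl, bDr, bNl, bNr, bZl, bZr) (bC e v) bvv.
  have E : s * (s * b e e) = b e e by rewrite mulrA s2 mul1r.
  by rewrite E; ring.
have vR : v *m R = s *: e.
  rewrite /R mulmxBr mulmx1 -scalemxAr !mulmxA bE mul_scalar_mx scalerA.
  have -> : k * b v w = 1 by rewrite /k mulrAC bvw divff.
  by rewrite scale1r wE opprB addrC subrK.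
have : (s - 1) * (s + 1) = s * s - 1 by ring.
move/eqP; rewrite s2 subrr mulf_eq0 subr_eq0 addr_eq0 => /orP[] /eqP se; rewrite vR se.
  by left; rewrite scale1r.
by right; rewrite scaleN1r.
Qed.

Definition first_row n : 'rV[F]_(1 + n) := row_mx 1%:M 0.

Lemma first_row_form n (a : F) (A : 'M[F]_n) :
  first_row n *m block_mx (a%:M : 'M_1) 0 0 A *m (first_row n)^T = a%:M.
Proof.
rewrite /first_row mul_row_block tr_row_mx mul_row_col trmx1 trmx0.
by rewrite !(mul1mx, mulmx1, mul0mx, mulmx0, addr0).
Qed.

(** Witt cancellation: after a reflection the isometry maps the first basis vector
    to itself up to sign, hence preserves its orthogonal complement. *)
Lemma congruent_cancel m n (a : F) (A : 'M[F]_m) (B : 'M[F]_n) : a != 0 -> B^T = B ->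
  congruent (block_mx (a%:M : 'M_1) 0 0 A) (block_mx (a%:M : 'M_1) 0 0 B) -> congruent A B.
Proof.
move=> a0 sB [P [P' [PP' P'P PBP]]].
set G := block_mx a%:M 0 0 B in PBP; pose v := first_row m *m P.
have sG : G^T = G by rewrite /G tr_block_mx !trmx0 tr_scalar_mx sB.
have vG : v *m G *m v^T = a%:M.
  by rewrite /v trmx_mul !mulmxA -(mulmxA _ P) -(mulmxA _ (P *m G)) PBP first_row_form.
have eG := first_row_form a B; rewrite -/G in eG.
have [||R [RR RGR] vR] := @reflection_fix _ G v (first_row n) sG.
- by rewrite vG eG.
- by rewrite eG mxE eqxx mulr1n.
pose M := P *m R; pose M' := R *m P'.
have MM' : M *m M' = 1%:M by rewrite /M /M' mulmxA -(mulmxA P) RR mulmx1.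
have M'M : M' *m M = 1%:M by rewrite /M /M' mulmxA -(mulmxA R) P'P mulmx1.
have MGM : M *m G *m M^T = block_mx a%:M 0 0 A.
  by rewrite /M trmx_mul !mulmxA -(mulmxA P) -(mulmxA _ _ R^T) RGR.
have [s [s2 eM]] : exists s : F, s * s = 1 /\ first_row m *m M = s *: first_row n.
  rewrite /M mulmxA -/v; case: vR => ->.
    by exists 1; rewrite mulr1 scale1r.
  by exists (-1); rewrite mulrNN mulr1 scaleN1r.
have s0 : s != 0 by apply/eqP => s0; move: s2; rewrite s0 mul0r => /esym/eqP; rewrite oner_eq0.
move: MM' M'M MGM eM; rewrite -[M]submxK -[M']submxK.
move: (ulsubmx M) (ursubmx M) (dlsubmx M) (drsubmx M) => x y X Y.
move: (ulsubmx M') (ursubmx M') (dlsubmx M') (drsubmx M') => x' y' X' Y'.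
rewrite /first_row mul_row_block !mul1mx !mul0mx !addr0 scale_row_mx scaler0.
move=> MM' M'M MGM /eq_row_mx[ex ey]; move: MM' M'M MGM; rewrite ex ey {x y ex ey}.
rewrite tr_block_mx !mulmx_block !trmx0 !(mul0mx, mulmx0, addr0, add0r).
rewrite !scalar_mx_block => /eq_block_mx[_ _ _ YY'] /eq_block_mx[_ _ _ Y'Y].
move=> /eq_block_mx[_ _ Xa YBY].
have X0 : X = 0.
  move: Xa; rewrite linearZ /= trmx1 -scalemxAr mulmx1 mul_mx_scalar scalerA.
  by move/eqP; rewrite scaler_eq0 mulf_eq0 (negbTE s0) (negbTE a0) => /eqP.
move: YY' YBY; rewrite X0 !mul0mx !add0r => YY' YBY.
by exists Y, Y'.
Qed.

End Congruence.

(** * Diagonal forms *)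

Section Diagonal.
Variable F : fieldType.
Implicit Types (s t : seq F) (a b c d : F).

Definition diagm s : 'M[F]_(size s) := diag_mx (\row_(i < size s) s`_i).

Lemma congruent_diag_cast m n (d : 'rV[F]_m) (d' : 'rV[F]_n) : m = n ->
  (forall (i : 'I_m) (j : 'I_n), i = j :> nat -> d 0 i = d' 0 j) ->
  congruent (diag_mx d) (diag_mx d').
Proof.
move=> e; case: n / e d' => d' E; rewrite (_ : d = d'); first exact: congruent_refl.
by apply/rowP => i; apply: E.
Qed.

Lemma diagm_cat s t : congruent (block_mx (diagm s) 0 0 (diagm t)) (diagm (s ++ t)).
Proof.
rewrite /diagm -diag_mx_row; apply: congruent_diag_cast; first by rewrite size_cat.
move=> i j ij; rewrite !mxE nth_cat -ij.
case: splitP => k -> /=; rewrite !mxE ?ltn_ord //.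
by rewrite addnC addnK.
Qed.

Definition rv_seq n (d : 'rV[F]_n) := [seq d 0 i | i <- enum 'I_n].

Lemma diagm_rv_seq n (d : 'rV[F]_n) : congruent (diag_mx d) (diagm (rv_seq d)).
Proof.
have e : n = size (rv_seq d) by rewrite size_map size_enum_ord.
apply: congruent_diag_cast => // i j ij; rewrite mxE -ij.
by rewrite (nth_map i) ?size_enum_ord ?ltn_ord // nth_ord_enum.
Qed.

Definition diag_iso s t := congruent (diagm s) (diagm t).

Lemma diag_iso_refl s : diag_iso s s. Proof. exact: congruent_refl. Qed.

Lemma diag_iso_sym s t : diag_iso s t -> diag_iso t s. Proof. exact: congruent_sym. Qed.

Lemma diag_iso_trans s t r : diag_iso s t -> diag_iso t r -> diag_iso s r.
Proof. exact: congruent_trans. Qed.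

Lemma diag_iso_cat s s' t t' : diag_iso s s' -> diag_iso t t' -> diag_iso (s ++ t) (s' ++ t').
Proof.
move=> ss tt; apply: congruent_trans (congruent_sym (diagm_cat s t)) _.
exact: congruent_trans (congruent_block ss tt) (diagm_cat s' t').
Qed.

Lemma diag_iso_cons a s t : diag_iso s t -> diag_iso (a :: s) (a :: t).
Proof. exact: (diag_iso_cat (diag_iso_refl [:: a])). Qed.

Lemma diagm1 a : diagm [:: a] = a%:M :> 'M_1.
Proof. by apply/matrixP => i j; rewrite !mxE [i]ord1 [j]ord1. Qed.

Lemma diagm_cons a s : diagm (a :: s) = block_mx (a%:M : 'M_1) 0 0 (diagm s) :> 'M_(1 + size s).
Proof.
apply/matrixP => i j; rewrite !mxE.
case: (splitP i) => i' ei; rewrite mxE; case: (splitP j) => j' ej; rewrite !mxE -val_eqE /= ei ej.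
- by rewrite [i']ord1 [j']ord1.
- by rewrite [i']ord1.
- by rewrite [j']ord1.
- by rewrite eqSS.
Qed.

Lemma diagm2 a b : diagm [:: a; b] = block_mx (a%:M : 'M_1) 0 0 (b%:M : 'M_1).
Proof. by rewrite diagm_cons diagm1. Qed.

Lemma diag_iso2 a b c d (x y z w : F) : x * w - y * z != 0 ->
  c = a * x ^+ 2 + b * y ^+ 2 -> d = a * z ^+ 2 + b * w ^+ 2 ->
  a * x * z + b * y * w = 0 -> diag_iso [:: c; d] [:: a; b].
Proof.
move=> k0 -> -> orth; rewrite /diag_iso !diagm2.
pose k := x * w - y * z.
pose P : 'M[F]_(1 + 1) := block_mx (x%:M : 'M_1) y%:M z%:M w%:M.
pose P' : 'M[F]_(1 + 1) := block_mx ((w / k)%:M : 'M_1) (- y / k)%:M (- z / k)%:M (x / k)%:M.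
have sc (u v u' v' : F) : (u%:M : 'M_1) *m v%:M + (u'%:M : 'M_1) *m v'%:M = (u * v + u' * v')%:M.
  by rewrite -!scalar_mxM raddfD.
have s1 : (1%:M : 'M[F]_(1 + 1)) = block_mx (1%:M : 'M_1) 0%:M 0%:M 1%:M.
  by rewrite scalar_mx_block raddf0.
have PP' : P *m P' = 1%:M.
  by rewrite /P /P' mulmx_block !sc s1; congr block_mx; congr (_%:M); rewrite /k; field.
have P'P : P' *m P = 1%:M.
  by rewrite /P /P' mulmx_block !sc s1; congr block_mx; congr (_%:M); rewrite /k; field.
exists P, P'; split=> //.
have -> : (0 : 'M[F]_1) = 0%:M by rewrite raddf0.
suff : P *m block_mx (a%:M : 'M_1) 0%:M 0%:M (b%:M : 'M_1) *m P^T =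
  block_mx (a * x ^+ 2 + b * y ^+ 2)%:M 0%:M 0%:M (a * z ^+ 2 + b * w ^+ 2)%:M by [].
rewrite /P tr_block_mx !tr_scalar_mx !mulmx_block !sc.
by congr block_mx; congr (_%:M); first [ring |
  transitivity (a * x * z + b * y * w); [ring | exact: orth]].
Qed.

Lemma diag_iso_swap a b : diag_iso [:: a; b] [:: b; a].
Proof.
apply: (@diag_iso2 _ _ _ _ 0 1 1 0); rewrite ?expr1n ?expr0n ?mulr0 ?mulr1 ?mul0r ?add0r ?addr0 //.
by rewrite oppr_eq0 oner_neq0.
Qed.

Lemma diag_iso_swap_head a b s : diag_iso (a :: b :: s) (b :: a :: s).
Proof. exact: (diag_iso_cat (diag_iso_swap a b) (diag_iso_refl s)). Qed.

Lemma diag_iso_perm s t : perm_eq s t -> diag_iso s t.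
Proof.
have mem x l : x \in l -> diag_iso l (x :: rem x l).
  elim: l => // y l IH; rewrite inE /= eq_sym => /predU1P[->|xl].
    by rewrite eqxx; apply: diag_iso_refl.
  case: eqP => [->|_]; first exact: diag_iso_refl.
  exact: diag_iso_trans (diag_iso_cons _ (IH xl)) (diag_iso_swap_head _ _ _).
elim: s t => [|x s IH] t p.
  by move: p; rewrite perm_sym => /perm_nilP ->; apply: diag_iso_refl.
have xt : x \in t by rewrite -(perm_mem p) mem_head.
apply: diag_iso_trans (diag_iso_sym (mem x t xt)); apply/diag_iso_cons/IH.
by rewrite -(perm_cons x); apply: perm_trans p (perm_to_rem xt).
Qed.

(** The second vector, of coordinates - d y and a x, is orthogonal to the first. *)
Lemma diag_iso_binary a d (x y : F) : a != 0 -> d != 0 ->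
  a * x ^+ 2 + d * y ^+ 2 != 0 ->
  diag_iso [:: a; d] [:: a * x ^+ 2 + d * y ^+ 2; a * d * (a * x ^+ 2 + d * y ^+ 2)].
Proof.
move=> a0 d0 c0; apply/diag_iso_sym.
apply: (@diag_iso2 _ _ _ _ x y (- (d * y)) (a * x)) => //; try ring.
by move: c0; congr (_ != 0); ring.
Qed.

Lemma diag_iso_scale a (k : F) : k != 0 -> diag_iso [:: a * k ^+ 2] [:: a].
Proof.
move=> k0; rewrite /diag_iso !diagm1; exists k%:M, k^-1%:M; rewrite -!scalar_mxM tr_scalar_mx -scalar_mxM.
by rewrite divff // mulVf //; split=> //; congr (_%:M); ring.
Qed.

Definition all_neq0 s := all (fun a => a != 0) s.

Lemma diagm_unit s : (diagm s \in unitmx) = all_neq0 s.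
Proof.
rewrite unitmxE det_diag unitfE.
apply/idP/idP => [/prodf_neq0 H|/allP H].
  apply/allP => a /(nthP 0)[i si <-]; have := H (Ordinal si) isT.
  by rewrite mxE.
by apply/prodf_neq0 => i _; rewrite mxE; apply/H/mem_nth.
Qed.

End Diagonal.

(** * Invariance of Witt functions over a rigid field *)

Section Rigid.
Variable F : fieldType.
Hypothesis F2 : (2 : F) != 0.
Hypothesis F_rigid : rigid F.
Implicit Types (s t : seq F) (a b c d x y : F).

Definition eps : sqclass F := sqcl (-1).
Definition level_le2 := exists x y, x ^+ 2 + y ^+ 2 = -1.

Definition witt_fun (A : zmodType) (h : sqclass F -> A) := admissible eps level_le2 h.

Definition form_sum (A : zmodType) (h : sqclass F -> A) s := wsum h (map (@sqcl F) s).

Lemma form_sum_cons (A : zmodType) (h : _ -> A) a s : form_sum h (a :: s) = h (sqcl a) + form_sum h s.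
Proof. exact: wsum_cons. Qed.

Lemma form_sum_nil (A : zmodType) (h : _ -> A) : form_sum h [::] = 0.
Proof. exact: big_nil. Qed.

Lemma form_sum_cat (A : zmodType) (h : _ -> A) s t : form_sum h (s ++ t) = form_sum h s + form_sum h t.
Proof. by rewrite /form_sum map_cat wsum_cat. Qed.

Lemma form_sum_perm (A : zmodType) (h : _ -> A) s t : perm_eq s t -> form_sum h s = form_sum h t.
Proof. by move=> p; apply/wsum_perm/perm_map. Qed.

Lemma sqclass2C (v w : sqclass F) : v + w + w = v.
Proof. exact: (addVK (@sqclass2 F)). Qed.

Lemma qval_binary a d (a0 : a != 0) (d0 : d != 0) (v : 'rV_(1 + 1)) :
  qval (q := qsum (qunary a0) (qunary d0)) v =
  a * (lsubmx v 0 0) ^+ 2 + d * (rsubmx v 0 0) ^+ 2.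
Proof.
rewrite /qval /= -{1 2}[v]hsubmxK mul_row_block tr_row_mx mul_row_col.
rewrite !mulmx0 addr0 add0r !mul_mx_scalar -!scalemxAl.
have E (u : 'M[F]_1) k : (k *: (u *m u^T)) 0 0 = k * u 0 0 ^+ 2.
  by rewrite 2!mxE big_ord1 mxE expr2.
by rewrite mxE !E.
Qed.

Lemma rigid_binary a d : a != 0 -> d != 0 ->
  (forall x y, a * x ^+ 2 + d * y ^+ 2 = 0 -> x = 0 /\ y = 0) ->
  exists u v, forall x y, a * x ^+ 2 + d * y ^+ 2 != 0 ->
    sqcl (a * x ^+ 2 + d * y ^+ 2) = u \/ sqcl (a * x ^+ 2 + d * y ^+ 2) = v.
Proof.
move=> a0 d0 an; pose q := qsum (qunary a0) (qunary d0).
have [|u [v [u0 v0 H]]] := @F_rigid q erefl.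
  move=> v; rewrite qval_binary => /an[l0 r0].
  rewrite -[v]hsubmxK [lsubmx v]mx11_scalar [rsubmx v]mx11_scalar l0 r0.
  by rewrite !raddf0 row_mx0.
exists (sqcl u), (sqcl v) => x y c0.
have [|uc|vc] := H (a * x ^+ 2 + d * y ^+ 2).
- split=> //; exists (row_mx x%:M y%:M); rewrite qval_binary.
  by rewrite row_mxKl row_mxKr !mxE eqxx !mulr1n.
- by left; apply/sqcl_eq.
- by right; apply/sqcl_eq.
Qed.

(** Let t = x^2 + y^2.  The form <1,-t> represents 1, -t and x^2 - t = - y^2, so two
    of the classes of 1, -t and -1 coincide. *)
Lemma rigid_sum_sqr x y : x ^+ 2 + y ^+ 2 != 0 -> sqcl (x ^+ 2 + y ^+ 2) != 0 ->
  eps != 0 -> sqcl (x ^+ 2 + y ^+ 2) = eps.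
Proof.
set t := x ^+ 2 + y ^+ 2 => t0 ct e0.
have Nt0 : - t != 0 by rewrite oppr_eq0.
have y0 : y != 0.
  apply: contraNneq ct => y0; move: t0; rewrite /t y0 expr0n addr0.
  rewrite sqrf_eq0 => x0; have := sqclMsqr (oner_neq0 F) x0; rewrite mul1r => -> //.
have [|u [v H]] := @rigid_binary 1 (- t) (oner_neq0 F) Nt0.
  move=> X Y; rewrite mul1r mulNr => /eqP; rewrite subr_eq0 => /eqP XY.
  have [Y0|Y0] := eqVneq Y 0.
    by move: XY; rewrite Y0 expr0n mulr0 => /eqP; rewrite sqrf_eq0 => /eqP ->.
  have X0 : X != 0 by rewrite -sqrf_eq0 XY mulf_neq0 ?expf_neq0.
  have := sqclMsqr t0 Y0; rewrite -XY => E; move: ct; rewrite -E.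
  by have := sqclMsqr (oner_neq0 F) X0; rewrite mul1r => ->; rewrite eqxx.
have := H 1 0; rewrite !(expr1n, expr0n, mulr1, mulr0, addr0) => /(_ (oner_neq0 F)) H1.
have := H 0 1; rewrite !(expr1n, expr0n, mulr1, mulr0, add0r) => /(_ Nt0) H2.
have := H x 1; rewrite expr1n mulr1 mul1r /t opprD addNKr.
have -> : - y ^+ 2 = -1 * y ^+ 2 by rewrite mulN1r.
rewrite mulf_neq0 ?oppr_eq0 ?oner_neq0 ?expf_neq0 // => /(_ isT).
rewrite sqclMsqr ?oppr_eq0 ?oner_neq0 // -/eps => H3.
have c1 : sqcl (1 : F) = 0 by [].
move: H1 H2 H3; rewrite sqclN // c1 -/eps.
have key : sqcl t + eps = 0 -> sqcl t = eps by apply/sum_pair0/sqclass2.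
case=> <-.
  case=> [/key//|<-]; case=> [/eqP|e]; first by rewrite (negbTE e0).
  by move: ct; rewrite -(inj_eq (addIr eps)) add0r -e eqxx.
case=> [<-|/key//]; case=> [e|/eqP]; last by rewrite (negbTE e0).
by move: ct; rewrite -(inj_eq (addIr eps)) add0r -e eqxx.
Qed.

(** Rigidity leaves few binary isometries.  If <a,d> is hyperbolic, both sides
    vanish; if a and d are in different square classes, c is in one of them and
    a d c in the other; if they are in the same class, then c is in that class or
    in the opposite one, and in the latter case -1 is a sum of two squares. *)
Lemma witt_fun_binary (A : zmodType) (h : sqclass F -> A) a d x y :
  witt_fun h -> a != 0 -> d != 0 -> a * x ^+ 2 + d * y ^+ 2 != 0 ->
  h (sqcl a) + h (sqcl d) = h (sqcl (a * x ^+ 2 + d * y ^+ 2)) +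
    h (sqcl (a * d * (a * x ^+ 2 + d * y ^+ 2))).
Proof.
move=> [hN h4] a0 d0; set c := _ + _ => c0.
rewrite (sqclM (mulf_neq0 a0 d0) c0) (sqclM a0 d0).
have [da|da] := eqVneq (sqcl d) (sqcl a + eps).
  by rewrite da addrA sqclass2 add0r hN addrN [eps + _]addrC hN addrN.
have [|u [v H]] := rigid_binary a0 d0.
  move=> X Y E; have [Y0|Y0] := eqVneq Y 0.
    move: E; rewrite Y0 expr0n mulr0 addr0 => /eqP; rewrite mulf_eq0 (negbTE a0).
    by rewrite sqrf_eq0 => /eqP ->.
  have [X0|X0] := eqVneq X 0.
    move: E; rewrite X0 expr0n mulr0 add0r => /eqP; rewrite mulf_eq0 (negbTE d0).
    by rewrite sqrf_eq0 (negbTE Y0).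
  case/eqP: da; rewrite -sqclN // -(sqclMsqr d0 Y0) -(sqclMsqr (x := - a) _ X0) ?oppr_eq0 //.
  by congr sqcl; move/eqP: E; rewrite addr_eq0 mulNr => /eqP ->; rewrite opprK.
have := H x y c0; rewrite -/c.
have := H 1 0; rewrite !(expr1n, expr0n, mulr1, mulr0, addr0) => /(_ a0).
have := H 0 1; rewrite !(expr1n, expr0n, mulr1, mulr0, add0r) => /(_ d0).
have [ad|ad] := eqVneq (sqcl a) (sqcl d); last first.
  have E : sqcl c = sqcl a \/ sqcl c = sqcl d ->
     h (sqcl a) + h (sqcl d) = h (sqcl c) + h (sqcl a + sqcl d + sqcl c).
    case=> ->; last by rewrite sqclass2C addrC.
    by rewrite addrAC sqclass2 add0r.
  move=> Hd Ha Hc; apply: E; move: ad.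
  by case: Hd Ha Hc => -> [] -> [] ->; rewrite ?eqxx //; auto.
move=> _ _ _; rewrite -ad sqclass2 add0r.
have [-> //|ca] := eqVneq (sqcl c) (sqcl a).
have e0 : eps != 0 by apply: contraNneq da => ->; rewrite addr0 ad.
have [k k0 dk] : same_square_class d a by apply/sqcl_eq.
have cE : c = a * (x ^+ 2 + (k * y) ^+ 2) by rewrite /c dk; ring.
have t0 : x ^+ 2 + (k * y) ^+ 2 != 0.
  by apply: contraNneq c0 => t0; rewrite cE t0 mulr0.
have cle : sqcl c = sqcl a + sqcl (x ^+ 2 + (k * y) ^+ 2) by rewrite cE sqclM.
have te : sqcl (x ^+ 2 + (k * y) ^+ 2) = eps.
  by apply: rigid_sum_sqr => //; apply: contraNneq ca => t1; rewrite cle t1 addr0.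
have fl : level_le2.
  have [w w0 tw] : same_square_class (x ^+ 2 + (k * y) ^+ 2) (-1).
    by apply/sqcl_eq => //; rewrite oppr_eq0 oner_neq0.
  exists (x / w), (k * y / w); rewrite !expr_div_n -mulrDl tw mulfK ?expf_neq0 //.
have := h4 fl (sqcl a); rewrite cle te hN !mulrS mulr0n addr0 => h4a.
by apply/eqP; rewrite -subr_eq0 opprD !opprK -addrA h4a.
Qed.

Definition represented s c :=
  exists2 xs, size xs = size s & c = \sum_(p <- zip s xs) p.1 * p.2 ^+ 2.

Lemma diagm_form s (v : 'rV_(size s)) :
  (v *m diagm s *m v^T) 0 0 = \sum_(i < size s) s`_i * v 0 i ^+ 2.
Proof.
rewrite /diagm mul_mx_diag mxE; apply: eq_bigr => i _; rewrite !mxE.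
by rewrite expr2; ring.
Qed.

Lemma represented_diagm s (v : 'rV_(size s)) : represented s ((v *m diagm s *m v^T) 0 0).
Proof.
exists (rv_seq v); first by rewrite size_map size_enum_ord.
rewrite diagm_form (big_nth (0, 0)) size_zip size_map size_enum_ord minnn big_mkord.
apply: eq_bigr => i _; rewrite nth_zip /=; last by rewrite size_map size_enum_ord.
by rewrite (nth_map i) ?size_enum_ord // nth_ord_enum.
Qed.

(** A represented value can be split off by binary isometries only, one coefficient
    at a time; that is why the sum of a Witt function does not change. *)
Lemma represented_split s c : all_neq0 s -> c != 0 -> represented s c ->
  exists s', [/\ all_neq0 s', diag_iso s (c :: s') &
    forall (A : zmodType) (h : sqclass F -> A), witt_fun h -> form_sum h s = h (sqcl c) + form_sum h s'].
Proof.
elim: s c => [|a s IH] c nzs c0 [[|x xs]] //=.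
  by move=> _ e; move: c0; rewrite e big_nil eqxx.
case/andP: nzs => a0 nzs; case=> sxs; rewrite big_cons /=.
set e := \sum_(_ <- _) _ => ce.
have re : represented s e by exists xs.
have [e0|e0] := eqVneq e 0.
  have x0 : x != 0 by apply: contraNneq c0 => x0; rewrite ce x0 e0 expr0n mulr0 addr0.
  rewrite e0 addr0 in ce; exists s; split=> // [|A h hh]; last first.
    by rewrite form_sum_cons ce sqclMsqr.
  rewrite ce; exact: (diag_iso_cat (diag_iso_sym (diag_iso_scale a x0)) (diag_iso_refl s)).
have [s' [nz' iso Js]] := IH e nzs e0 re.
have [x0|x0] := eqVneq x 0.
  have {}ce : c = e by rewrite ce x0 expr0n mulr0 add0r.
  exists (a :: s'); split; first by rewrite /= a0.
    rewrite ce; apply: diag_iso_trans (diag_iso_cons a iso) (diag_iso_swap_head _ _ _).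
  by move=> A h hh; rewrite !form_sum_cons (Js _ _ hh) ce addrCA.
have c1 : a * x ^+ 2 + e * 1 ^+ 2 = c by rewrite expr1n mulr1 ce.
exists (a * e * c :: s'); split.
- by rewrite /= !mulf_neq0.
- apply: diag_iso_trans (diag_iso_cons a iso) _.
  have := diag_iso_binary (x := x) (y := 1) a0 e0; rewrite c1 => /(_ c0) H.
  exact: (diag_iso_cat H (diag_iso_refl s')).
move=> A h hh; rewrite !form_sum_cons (Js _ _ hh) !addrA; congr (_ + _).
by have := witt_fun_binary (x := x) (y := 1) hh a0 e0; rewrite c1 => /(_ c0).
Qed.

Lemma diag_iso_all_neq0 s t : diag_iso s t -> all_neq0 s -> all_neq0 t.
Proof. by rewrite -!diagm_unit; apply: congruent_unit. Qed.

(** The head of t is represented by s; it is split off from s and then cancelled. *)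
Lemma form_sum_diag_iso s t : all_neq0 s -> diag_iso s t ->
  forall (A : zmodType) (h : sqclass F -> A), witt_fun h -> form_sum h s = form_sum h t.
Proof.
elim: t s => [|b t IH] s nzs st A h hh.
  case: st => P [P' [PP' _ _]]; case: s nzs P P' PP' => // a s _ P P'.
  rewrite [P]thinmx0 mul0mx => /matrixP/(_ 0 0); rewrite !mxE eqxx mulr1n => /eqP.
  by rewrite eq_sym oner_eq0.
have := diag_iso_all_neq0 st nzs => /= /andP[b0 nzt].
have [s' [nz' ss' Js]] : exists s', [/\ all_neq0 s', diag_iso s (b :: s') &
    forall (A : zmodType) (h : sqclass F -> A), witt_fun h -> form_sum h s = h (sqcl b) + form_sum h s'].
  apply: represented_split => //.
  have [P [P' [_ _ PDP]]] := diag_iso_sym st.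
  have := represented_diagm ((@first_row F (size t) : 'rV_(size (b :: t))) *m P).
  rewrite trmx_mul !mulmxA -(mulmxA _ P) -(mulmxA _ (P *m _)) PDP diagm_cons.
  by rewrite first_row_form mxE eqxx mulr1n.
rewrite (Js _ _ hh) form_sum_cons; congr (_ + _); apply: IH => //.
have bb : diag_iso (b :: s') (b :: t) by apply: diag_iso_trans (diag_iso_sym ss') st.
apply: (congruent_cancel F2 b0 (tr_diag_mx _)); rewrite -!diagm_cons; exact: bb.
Qed.

End Rigid.

(** * Quadratic forms and the third power of the fundamental ideal *)

Section Forms.
Variable F : fieldType.
Hypothesis F2 : (2 : F) != 0.
Implicit Types (s t : seq F) (a b c d x y : F) (q p : qform F).

Lemma isometric_congruent q p : isometric q p <-> congruent (gram q) (gram p).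
Proof.
split=> [[f [[g fK gK] fq]]|[P [P' [PP' P'P PGP]]]].
  pose P := lin1_mx f.
  have Pf v : v *m P = f v by rewrite mul_rV_lin1.
  have free : row_free P.
    apply: inj_row_free => v; rewrite Pf => fv.
    by rewrite -[v]fK fv -(raddf0 f) fK.
  have full : row_full P.
    rewrite -sub1mx; apply/row_subP => i; rewrite -[row i _]gK -Pf.
    exact: submxMl.
  exists P, (pinvmx P); split; [exact: mulmxVp | exact: mulVpmx |].
  apply/eqP; rewrite -subr_eq0; apply/eqP/(quadratic_eq0 F2).
    by rewrite linearB /= !trmx_mul trmxK !gram_sym mulmxA.
  have mxB (X Y : 'M[F]_1) : (X - Y) 0 0 = X 0 0 - Y 0 0 by rewrite !mxE.
  move=> v; rewrite mulmxBr mulmxBl mxB.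
  have := fq v; rewrite /qval -Pf trmx_mul !mulmxA => ->.
  by rewrite subrr.
exists (mulmxr P); split.
  by exists (mulmxr P') => v /=; rewrite -mulmxA ?PP' ?P'P mulmx1.
by move=> v; rewrite /qval /= trmx_mul -PGP !mulmxA.
Qed.

Definition diag_of q s := congruent (gram q) (diagm s).

Lemma diag_of_all_neq0 q s : diag_of q s -> all_neq0 s.
Proof. by move=> qs; rewrite -diagm_unit; apply: congruent_unit qs (gram_unit q). Qed.

Lemma diag_of_size q s : diag_of q s -> size s = qdim q.
Proof.
case=> P [P' [PP' P'P _]]; apply/eqP; rewrite eqn_leq.
by rewrite (mulmx1_min PP') (mulmx1_min P'P).
Qed.

Lemma ex_diag q : exists s, diag_of q s.
Proof.
have [d qd] := diagonalize F2 (gram_sym q).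
by exists (rv_seq d); apply: congruent_trans qd (diagm_rv_seq d).
Qed.

Lemma diag_of_diag_iso q s t : diag_of q s -> diag_of q t -> diag_iso s t.
Proof. by move=> qs qt; apply: congruent_trans (congruent_sym qs) qt. Qed.

Lemma diag_of_qsum q p s t : diag_of q s -> diag_of p t -> diag_of (qsum q p) (s ++ t).
Proof. by move=> qs pt; apply: congruent_trans (congruent_block qs pt) (diagm_cat s t). Qed.

Lemma diag_of_qunary a (a0 : a != 0) : diag_of (qunary a0) [:: a].
Proof. by rewrite /diag_of diagm1; apply: congruent_refl. Qed.

Lemma diag_of_qzero : diag_of (qzero F) [::].
Proof. by rewrite /diag_of [diagm _]flatmx0; apply: congruent_refl. Qed.

Lemma diag_of_qscale c (c0 : c != 0) q s :
  diag_of q s -> diag_of (qscale c0 q) (map ( *%R c) s).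
Proof.
move=> qs; apply: congruent_trans (congruent_scale c qs) _.
rewrite (_ : c *: diagm s = diag_mx (c *: \row_i s`_i)); last by rewrite linearZ.
apply: congruent_diag_cast; first by rewrite size_map.
by move=> i j ij; rewrite !mxE (nth_map 0) -?ij.
Qed.

(** The order of the entries of the Kronecker product is immaterial, so they are
    described only through sums over them. *)
Lemma diag_of_qtensor q p s t : diag_of q s -> diag_of p t ->
  exists2 r, diag_of (qtensor q p) r & forall (A : zmodType) (h : sqclass F -> A),
    form_sum h r = \sum_(x <- s) form_sum (fun v => h (sqcl x + v)) t.
Proof.
move=> qs pt; pose d : 'rV[F]_(size s * size t) :=
  \row_k (s`_(mxtens_unindex k).1 * t`_(mxtens_unindex k).2).
have nzs := diag_of_all_neq0 qs; have nzt := diag_of_all_neq0 pt.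
exists (rv_seq d).
  apply: congruent_trans (congruent_tens qs pt) _.
  rewrite (_ : _ *t _ = diag_mx d); first exact: diagm_rv_seq.
  apply/matrixP => i j; case: (mxtens_indexP i) => i1 i2; case: (mxtens_indexP j) => j1 j2.
  rewrite tensmxE !mxE (inj_eq (can_inj (@mxtens_indexK _ _))) xpair_eqE mxtens_indexK /=.
  by case: eqP => _; case: eqP => _; rewrite ?mulr0 ?mul0r ?mulr1n ?mulr0n.
move=> A h; have -> : form_sum h (rv_seq d) = \sum_k h (sqcl (d 0 k)).
  by rewrite /form_sum /wsum big_map big_map big_enum.
rewrite /form_sum /wsum.
rewrite (reindex (@mxtens_index (size s) (size t))) /=; last first.
  by exists (@mxtens_unindex _ _) => i _; rewrite ?mxtens_indexK ?mxtens_unindexK.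
rewrite (eq_bigr (fun k : 'I_(size s) * 'I_(size t) => h (sqcl (s`_(k.1) * t`_(k.2))))); last first.
  by move=> k _; rewrite mxE mxtens_indexK.
rewrite -(pair_bigA _ (fun (i : 'I_(size s)) (j : 'I_(size t)) => h (sqcl (s`_i * t`_j)))) /=.
rewrite (big_nth 0) big_mkord; apply: eq_bigr => i _.
rewrite big_map (big_nth 0) big_mkord; apply: eq_bigr => j _.
by rewrite sqclM //; [apply: (allP nzs) | apply: (allP nzt)]; rewrite mem_nth.
Qed.

Hypothesis F_rigid : rigid F.

Section Value.
Variables (A : zmodType).
Implicit Type h : sqclass F -> A.

(** A relation rather than a function: the diagonalization is not canonical. *)
Definition form_value q h v := exists2 s, diag_of q s & form_sum h s = v.

Lemma form_value_unique q h v w : witt_fun h -> form_value q h v -> form_value q h w -> v = w.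
Proof.
move=> hh [s qs <-] [t qt <-].
exact: (form_sum_diag_iso F2 F_rigid (diag_of_all_neq0 qs) (diag_of_diag_iso qs qt) hh).
Qed.

Lemma form_value_ex q h : exists v, form_value q h v.
Proof. by have [s qs] := ex_diag q; exists (form_sum h s), s. Qed.

Lemma form_value_qsum q p h v w : form_value q h v -> form_value p h w -> form_value (qsum q p) h (v + w).
Proof.
move=> [s qs <-] [t pt <-]; exists (s ++ t); first exact: diag_of_qsum.
exact: form_sum_cat.
Qed.

Lemma form_value_big k (X : 'I_k -> qform F) h (v : 'I_k -> A) :
  (forall i, form_value (X i) h (v i)) ->
  form_value (\big[@qsum F/qzero F]_(i < k) X i) h (\sum_(i < k) v i).
Proof.
move=> Xv; elim/big_rec2: _ => [|i q w _ qw].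
  by exists [::]; [apply: diag_of_qzero | apply: form_sum_nil].
exact: form_value_qsum.
Qed.

Lemma form_value_hyperbolic m h : witt_fun h -> form_value (hyperbolic F m) h 0.
Proof.
move=> [hN _]; have -> : 0 = \sum_(i < m) (0 : A) by rewrite big1.
apply: form_value_big => i; exists [:: 1; -1].
  have := diag_of_qsum (diag_of_qunary (oner_neq0 F)) (diag_of_qunary (qopp_neq0 (oner_neq0 F))).
  exact.
by rewrite !form_sum_cons form_sum_nil addr0 sqclN ?oner_neq0 // hN addrN.
Qed.

Lemma form_value_congruent q p h v : congruent (gram q) (gram p) -> form_value q h v -> form_value p h v.
Proof.
move=> qp [s qs <-]; exists s => //; exact: congruent_trans (congruent_sym qp) qs.
Qed.

Lemma form_value_witt_eq q p h v : witt_fun h -> witt_eq q p -> form_value p h v -> form_value q h v.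
Proof.
move=> hh [m [n /isometric_congruent/congruent_sym qp]] pv.
have /(form_value_congruent qp) := form_value_qsum pv (form_value_hyperbolic n hh).
have [w qw] := form_value_ex q h; have := form_value_qsum qw (form_value_hyperbolic m hh).
by move=> H1 H2; have := form_value_unique hh H1 H2; rewrite !addr0 => <-.
Qed.

(** The sum of h over the entries of a product with the form of entries t is the
    sum of this function over the entries of the other factor. *)
Definition convolve t h (v : sqclass F) := \sum_(y <- t) h (v + sqcl y).

Lemma convolve_witt_fun t h : witt_fun h -> witt_fun (convolve t h).
Proof.
move=> [hN h4]; split=> [v|fl v]; rewrite /convolve.
  by rewrite -sumrN; apply: eq_bigr => y _; rewrite addrAC hN.
by rewrite -sumrMnl big1 // => y _; apply: h4.
Qed.

Lemma form_value_qtensor q p t h v : diag_of p t -> form_value q (convolve t h) v ->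
  form_value (qtensor q p) h v.
Proof.
move=> pt [s qs <-]; have [r qpr Jr] := diag_of_qtensor qs pt.
exists r => //; rewrite Jr /form_sum /wsum big_map; apply: eq_bigr => x _.
by rewrite big_map.
Qed.

(** Vanishing of h on the multiples of n-fold Pfister forms <1,w1> ... <1,wn>. *)
Fixpoint kills n h := if n is n'.+1 then forall w : sqclass F, kills n' (fun v => h v + h (v + w))
  else forall v, h v = 0.

Lemma kills_ext n h h' : h =1 h' -> kills n h -> kills n h'.
Proof.
elim: n h h' => [|n IH] h h' E /= H; first by move=> v; rewrite -E H.
by move=> a; apply: IH (H a) => v; rewrite !E.
Qed.

Lemma kills_shift n h (u : sqclass F) : kills n h -> kills n (fun v => h (v + u)).
Proof.
elim: n h => [|n IH] h /= H; first by move=> v; apply: H.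
by move=> a; apply: kills_ext (IH _ (H a)) => v /=; rewrite addrAC.
Qed.

Lemma kills_add n h h' : kills n h -> kills n h' -> kills n (fun v => h v + h' v).
Proof.
elim: n h h' => [|n IH] h h' /= H H'; first by move=> v; rewrite H H' addr0.
by move=> a; apply: kills_ext (IH _ _ (H a) (H' a)) => v /=; rewrite addrACA.
Qed.

Lemma kills0 n : kills n (fun=> 0).
Proof. by elim: n => //= n IH a; apply: kills_ext IH => v; rewrite addr0. Qed.

(** A form of even dimension is a sum of binary forms <y,z> = y <1,yz>. *)
Lemma kills_convolve n h t : kills n.+1 h -> ~~ odd (size t) -> kills n (convolve t h).
Proof.
move=> kh; have [m] := ubnP (size t); elim: m t => // m IH [|y [|z t]] // st et.
  by apply: kills_ext (kills0 n) => v; rewrite /convolve big_nil.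
have kt : kills n (convolve t h).
  by apply: IH; move: st et => /=; rewrite ?negbK //; clear; lia.
apply: kills_ext (kills_add (kills_shift (sqcl y) (kh (sqcl y + sqcl z))) kt) => v.
by rewrite /= [v + _ + _]addrA sqclass2C /convolve !big_cons addrA.
Qed.

Lemma form_value_I1 q h : witt_fun h -> kills 1 h -> fund_ideal q -> form_value q h 0.
Proof.
move=> hh kh ev; have [s qs] := ex_diag q; exists s => //.
have := kills_convolve kh (t := s); rewrite (diag_of_size qs) => /(_ ev 0) <-.
by rewrite /convolve /form_sum /wsum big_map; apply: eq_bigr => y _; rewrite add0r.
Qed.

Lemma form_value_mul (I : qform F -> Prop) n q h :
  (forall h' p, witt_fun h' -> kills n h' -> I p -> form_value p h' 0) ->
  witt_fun h -> kills n.+1 h -> witt_ideal_mul I (@fund_ideal F) q -> form_value q h 0.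
Proof.
move=> HI hh kh [k [x [y [xy qxy]]]]; apply: (form_value_witt_eq hh qxy).
have -> : 0 = \sum_(i < k) (0 : A) by rewrite big1.
apply: form_value_big => i; have [Ix Iy] := xy i; have [t yt] := ex_diag (y i).
apply: (form_value_qtensor yt); apply: HI => //; first exact: convolve_witt_fun.
by apply: kills_convolve => //; rewrite (diag_of_size yt).
Qed.

Lemma form_value_I3 q h : witt_fun h -> kills 3 h -> fund_ideal3 q -> form_value q h 0.
Proof.
move=> hh kh; apply: (form_value_mul (n := 2)) => // h2 p hh2 kh2.
by apply: (form_value_mul (n := 1)) => // h1 p1 hh1 kh1; apply: form_value_I1.
Qed.

End Value.

Lemma fund_ideal3_in_I3 q s : diag_of q s -> fund_ideal3 q ->
  in_I3 (eps F) (level_le2 F) (map (@sqcl F) s).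
Proof.
move=> qs qI A h hh hflat.
have [t qt <-] : form_value q h 0.
  apply: form_value_I3 => // a b d v; have := hflat v a b d.
  rewrite /wsum /flat !big_cons big_nil addr0 => E; rewrite -[RHS]E.
  have e : v + d + b + a = v + a + b + d by char2 (@sqclass2 F).
  by rewrite e [v + b + a]addrAC [v + d + a]addrAC [v + d + b]addrAC !addrA.
exact: (form_sum_diag_iso F2 F_rigid (diag_of_all_neq0 qs) (diag_of_diag_iso qs qt) hh).
Qed.

End Forms.

(** * Anisotropy *)

Section Anisotropic.
Variable F : fieldType.
Implicit Types (s t : seq F) (a b c d x y : F).

Lemma anisotropic_seq s xs : anisotropic_mx (diagm s) -> size xs = size s ->
  \sum_(p <- zip s xs) p.1 * p.2 ^+ 2 = 0 -> all (pred1 0) xs.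
Proof.
move=> an sz sum0; pose v : 'rV[F]_(size s) := \row_i xs`_i.
have : v = 0.
  apply: an; rewrite diagm_form -[RHS]sum0 (big_nth (0, 0)) size_zip sz minnn big_mkord.
  by apply: eq_bigr => i _; rewrite nth_zip // mxE.
move=> v0; apply/(all_nthP 0) => i si; rewrite sz in si.
by have /rowP/(_ (Ordinal si)) := v0; rewrite !mxE /= => ->.
Qed.

Lemma sum_zip_nseq0 s : \sum_(p <- zip s (nseq (size s) 0)) p.1 * p.2 ^+ 2 = 0 :> F.
Proof.
elim: s => [|a s IH]; first by rewrite big_nil.
by rewrite /= big_cons IH expr0n mulr0 addr0.
Qed.

Lemma anisotropic_sqcl_pair s (v w : sqclass F) r : all_neq0 s -> anisotropic_mx (diagm s) ->
  perm_eq (map (@sqcl F) s) [:: v, w & r] -> v + w != eps F.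
Proof.
move=> nzs an p; have [s' ps' es'] := perm_map_lift p.
case: s' ps' es' => [|a [|b s']] // ps' [<- <- _].
have /and3P[a0 b0 _] : all_neq0 [:: a, b & s'] by rewrite /all_neq0 -(perm_all _ ps').
apply/eqP => ab.
have [k k0 bk] : same_square_class (- a) b.
  apply/sqcl_eq => //; first by rewrite oppr_eq0.
  by rewrite sqclN // -/(eps F) -ab addrA sqclass2 add0r.
have an' : anisotropic_mx (diagm [:: a, b & s']).
  exact: congruent_anisotropic (diag_iso_perm ps') an.
have := @anisotropic_seq _ [:: 1, k & nseq (size s') 0] an'.
rewrite /= size_nseq !big_cons sum_zip_nseq0 /= expr1n mulr1 -bk addr0 subrr.
by move=> /(_ erefl erefl); rewrite oner_eq0.
Qed.

(** If -1 = al^2 + be^2, then <1,1,1> has the isotropic vector (1, al, be). *)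
Lemma anisotropic_sqcl_triple s : all_neq0 s -> anisotropic_mx (diagm s) -> level_le2 F ->
  forall (v : sqclass F) r, ~~ perm_eq (map (@sqcl F) s) [:: v, v, v & r].
Proof.
move=> nzs an [al [be ab]] v r; apply/negP => p; have [s' ps' es'] := perm_map_lift p.
case: s' ps' es' => [|a [|b [|c s']]] // ps' [ea eb ec _].
have /and4P[a0 b0 c0 _] : all_neq0 [:: a, b, c & s'] by rewrite /all_neq0 -(perm_all _ ps').
have [k k0 bk] : same_square_class a b by apply/sqcl_eq => //; rewrite ea eb.
have [l l0 cl'] : same_square_class a c by apply/sqcl_eq => //; rewrite ea ec.
have an' : anisotropic_mx (diagm [:: a, b, c & s']).
  exact: congruent_anisotropic (diag_iso_perm ps') an.
have := @anisotropic_seq _ [:: 1, k * al, l * be & nseq (size s') 0] an'.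
rewrite /= size_nseq !big_cons sum_zip_nseq0 /= expr1n mulr1 addr0.
have -> : b * (k * al) ^+ 2 = a * al ^+ 2 by rewrite bk; ring.
have -> : c * (l * be) ^+ 2 = a * be ^+ 2 by rewrite cl'; ring.
rewrite -mulrDr ab mulrN1 subrr => /(_ erefl erefl).
by rewrite oner_eq0.
Qed.

End Anisotropic.

(** * Witt functions determine Witt classes *)

Section Hyperbolic.
Variable F : fieldType.
Hypothesis F2 : (2 : F) != 0.
Implicit Types (s t r : seq F) (a b c d x y : F).

Definition planes m : seq F := flatten (nseq m [:: 1; -1]).

Lemma diag_of_hyperbolic m : diag_of (hyperbolic F m) (planes m).
Proof.
elim: m => [|m IH]; rewrite /hyperbolic ?big_ord0 ?big_ord_recl.
  exact: diag_of_qzero.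
apply: (diag_of_qsum (s := [:: 1; -1])) IH.
exact: (diag_of_qsum (diag_of_qunary (oner_neq0 F)) (diag_of_qunary (qopp_neq0 (oner_neq0 F)))).
Qed.

Lemma diag_iso_sqcl a b : a != 0 -> b != 0 -> sqcl a = sqcl b -> diag_iso [:: a] [:: b].
Proof. by move=> a0 b0 /sqcl_eq[]// k k0 ->; apply: diag_iso_scale. Qed.

(** Since a X^2 - a Y^2 = a (X + Y) (X - Y), the value 1 is taken where X + Y = 1 and
    X - Y = 1 / a. *)
Lemma diag_iso_plane a b : a != 0 -> b != 0 -> sqcl b = sqcl a + eps F ->
  diag_iso [:: a; b] [:: 1; -1].
Proof.
move=> a0 b0 ab; have na0 : - a != 0 by rewrite oppr_eq0.
apply: (@diag_iso_trans _ _ [:: a; - a]).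
  apply: diag_iso_cons; apply: diag_iso_sqcl => //; by rewrite sqclN.
pose X := (1 + a^-1) / 2; pose Y := (1 - a^-1) / 2.
have E : a * X ^+ 2 + - a * Y ^+ 2 = 1 by rewrite /X /Y; field; rewrite a0 F2.
have := diag_iso_binary (x := X) (y := Y) a0 na0; rewrite E => /(_ (oner_neq0 F)) /diag_iso_trans; apply.
apply: diag_iso_cons; apply: diag_iso_sqcl; rewrite ?mulr1 ?mulf_neq0 ?oppr_eq0 ?oner_neq0 //.
by rewrite mulrN -expr2 -mulN1r sqclMsqr // oppr_eq0 oner_neq0.
Qed.

Lemma diag_iso_neg_pair a b : level_le2 F -> a != 0 -> b != 0 -> sqcl b = sqcl a ->
  diag_iso [:: a; b] [:: - a; - a].
Proof.
move=> [al [be ab]] a0 b0 ba.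
apply: (@diag_iso_trans _ _ [:: a; a]); first by apply/diag_iso_cons/diag_iso_sqcl.
have E : a * al ^+ 2 + a * be ^+ 2 = - a by rewrite -mulrDr ab mulrN1.
have := diag_iso_binary (x := al) (y := be) a0 a0; rewrite E oppr_eq0 => /(_ a0) /diag_iso_trans; apply.
apply: diag_iso_cons; apply: diag_iso_sqcl; rewrite ?mulf_neq0 ?oppr_eq0 //.
by rewrite mulrC -expr2 sqclMsqr ?oppr_eq0.
Qed.

Lemma has_perm r (P : pred F) : has P r -> exists b r', P b /\ perm_eq r (b :: r').
Proof.
by case/hasP => b br Pb; exists b, (rem b r); split=> //; apply: perm_to_rem.
Qed.

(** The coordinate of the Witt group at v. *)
Definition delta (R : pzRingType) (v w : sqclass F) : R :=
  (w == v)%:R - (w == v + eps F)%:R.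

Lemma delta_eps (R : pzRingType) v w : delta R v (w + eps F) = - delta R v w.
Proof.
have E (u u' : sqclass F) : (u + eps F == u') = (u == u' + eps F).
  by rewrite -[in RHS](inj_eq (addIr (eps F))) sqclass2C.
by rewrite /delta opprB !E sqclass2C.
Qed.

Lemma form_sum_delta (R : pzRingType) v r : ~~ has (fun y => sqcl y == v + eps F) r ->
  form_sum (delta R v) r = (count (fun y => sqcl y == v) r)%:R.
Proof.
elim: r => [|y r IH]; first by rewrite form_sum_nil.
rewrite /= negb_or => /andP[yv /IH Jr]; rewrite form_sum_cons Jr /delta (negbTE yv) subr0.
by rewrite natrD.
Qed.

(** Opposite entries are split off as hyperbolic planes.  When an entry a has no
    opposite left, its multiplicity is detected by [delta], or by an indicator
    function if eps = 0; it is 0 in Z, in Z/4 or in Z/2 according to the relations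
    in force.  Only the second is
    possible, and then four entries of the class of a make two hyperbolic planes. *)
Lemma witt_zero_hyperbolic r : all_neq0 r ->
  (forall (A : zmodType) (h : sqclass F -> A), witt_fun h -> form_sum h r = 0) ->
  exists m, diag_iso r (planes m).
Proof.
have [n] := ubnP (size r); elim: n r => // n IH [|a r] rn /=.
  by exists 0%N; apply: diag_iso_refl.
case/andP=> a0 nzr Jr.
have [hp|hn] := boolP (has (fun y => sqcl y == sqcl a + eps F) r).
  have [b [r' [/eqP ab p]]] := has_perm hp.
  have /= /andP[b0 nzr'] : all_neq0 (b :: r') by rewrite /all_neq0 -(perm_all _ p).
  have [||A h hh|m Hm] := IH r'.
  - by move: rn; rewrite /= (perm_size p) /=; clear; lia.
  - by [].
  - have := Jr _ _ hh; rewrite form_sum_cons (form_sum_perm _ p) form_sum_cons ab hh.1.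
    by rewrite addrA addrN add0r.
  exists m.+1; apply: (@diag_iso_trans _ _ [:: a, b & r']).
    exact/diag_iso_cons/diag_iso_perm.
  exact: (diag_iso_cat (diag_iso_plane a0 b0 ab) Hm).
have [e0|e0] := eqVneq (eps F) 0.
  pose h (v : sqclass F) : 'Z_2 := (v == sqcl a)%:R.
  have hh : witt_fun h.
    split=> [v|_ v]; rewrite /h ?e0 ?addr0; case: (v == _); exact: val_inj.
  have := Jr _ h hh; rewrite form_sum_cons /h eqxx.
  have -> : form_sum h r = 0.
    rewrite /form_sum /wsum big_map big_seq big1 // => y yr; rewrite /h.
    case: eqP => // ya; move/hasPn: hn => /(_ y yr).
    by rewrite e0 addr0 ya eqxx.
  by [].
have na : ~~ has (fun y => sqcl y == sqcl a + eps F) (a :: r).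
  by rewrite /= negb_or hn andbT -subr_eq0 opprD addrA subrr add0r oppr_eq0.
case: (EM (level_le2 F)) => [fl|nfl]; last first.
  have := Jr _ (delta int (sqcl a)); rewrite form_sum_delta // => H.
  have /H : witt_fun (delta int (sqcl a)) by split=> // v; apply: delta_eps.
  by rewrite /= eqxx => /eqP; rewrite Num.Theory.pnatr_eq0.
have : (4 %| count (fun y => sqcl y == sqcl a) (a :: r))%N.
  rewrite -Zp_nat_eq0 // -form_sum_delta // Jr //.
  by split=> [v|_ v]; [apply: delta_eps |
    rewrite -mulr_natr (_ : 4 = 0 :> 'Z_4) ?mulr0 //; apply: val_inj].
rewrite /= eqxx => /dvdnP[k Ek].
pose P y := sqcl y == sqcl a.
have ex3 (l : seq F) m : (m < count P l)%N -> exists b l',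
    [/\ sqcl b = sqcl a, perm_eq l (b :: l') & (m <= count P l')%N].
  move=> ml; have /has_perm[b [l' [/eqP ba p]]] : has P l.
    by rewrite has_count; apply: leq_ltn_trans ml.
  exists b, l'; split=> //; move: ml; rewrite (permP p) /= /P ba eqxx; clear; lia.
have c3 : (2 < count P r)%N by move: Ek; rewrite /P; clear; lia.
have [b1 [r1 [e1 p1 c2]]] := ex3 _ _ c3; have [b2 [r2 [e2 p2 c1]]] := ex3 _ _ c2.
have [b3 [r3 [e3 p3 _]]] := ex3 _ _ c1.
have p : perm_eq r [:: b1, b2, b3 & r3].
  apply: (perm_trans p1); rewrite perm_cons; apply: (perm_trans p2).
  by rewrite perm_cons.
have /= /and4P[b10 b20 b30 nz3] : all_neq0 [:: b1, b2, b3 & r3] by rewrite /all_neq0 -(perm_all _ p).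
have Na0 : - a != 0 by rewrite oppr_eq0.
have [||A h hh|m Hm] := IH r3.
- by move: rn; rewrite /= (perm_size p) /=; clear; lia.
- by [].
- have := Jr _ _ hh; rewrite form_sum_cons (form_sum_perm _ p) !form_sum_cons e1 e2 e3 !addrA.
  by have := hh.2 fl (sqcl a); rewrite !mulrS mulr0n addr0 !addrA => ->; rewrite add0r.
exists m.+2; apply: (@diag_iso_trans _ _ [:: a, b1, b2, b3 & r3]).
  exact/diag_iso_cons/diag_iso_perm.
apply: (@diag_iso_trans _ _ [:: - a, - a, b2, b3 & r3]).
  exact: (diag_iso_cat (diag_iso_neg_pair fl a0 b10 e1) (diag_iso_refl [:: b2, b3 & r3])).
apply: (@diag_iso_trans _ _ ([:: b2; - a] ++ [:: b3; - a] ++ r3)).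
  by apply: diag_iso_perm; apply/permP => Q /=; clear; lia.
apply: diag_iso_cat; first by apply: diag_iso_plane => //; rewrite sqclN // e2.
by apply: diag_iso_cat Hm; apply: diag_iso_plane => //; rewrite sqclN // e3.
Qed.

End Hyperbolic.

(** * Pfister forms and the main theorem *)

Section Final.
Variable F : fieldType.
Hypothesis F2 : (2 : F) != 0.

Lemma diag_of_pfister1 (a : {a : F | a != 0}) : diag_of (pfister1 a) [:: 1; - sval a].
Proof.
exact: (diag_of_qsum (diag_of_qunary (oner_neq0 F)) (diag_of_qunary (qopp_neq0 (svalP a)))).
Qed.

Lemma diag_of_pfister_cons (a : {a : F | a != 0}) l s : diag_of (pfister l) s ->
  exists2 r, diag_of (pfister (a :: l)) r & forall (A : zmodType) (h : sqclass F -> A),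
    form_sum h r = form_sum h s + form_sum (fun v => h (sqcl (- sval a) + v)) s.
Proof.
move=> ls; have [r ar Jr] := diag_of_qtensor (diag_of_pfister1 a) ls.
exists r => [|A h]; first by rewrite /pfister big_cons.
rewrite Jr !big_cons big_nil addr0; congr (_ + _).
by apply: eq_bigr => v _; rewrite add0r.
Qed.

Lemma diag_of_GP3 (c a b d : sqclass F) : exists pi r,
  [/\ GP 3 pi, diag_of pi r & forall (A : zmodType) (h : sqclass F -> A),
    form_sum h r = wsum h (flat c a b d)].
Proof.
have neg (v : sqclass F) : exists e : {e : F | e != 0}, sqcl (- sval e) = v.
  have v0 : - sqcl_repr v != 0 by rewrite oppr_eq0 sqcl_repr_neq0.
  by exists (exist (fun e : F => is_true (e != 0)) _ v0); rewrite /= opprK sqcl_reprK.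
have [a' <-] := neg a; have [b' <-] := neg b; have [d' <-] := neg d.
have one : diag_of (pfister [::] : qform F) [:: 1].
  by rewrite /pfister big_nil; apply: diag_of_qunary.
have [r1 p1 J1] := diag_of_pfister_cons a' one.
have [r2 p2 J2] := diag_of_pfister_cons b' p1.
have [r3 p3 J3] := diag_of_pfister_cons d' p2.
have c0 := sqcl_repr_neq0 c.
exists (qscale c0 (pfister [:: d'; b'; a'])), (map ( *%R (sqcl_repr c)) r3); split.
- exists [tuple d'; b'; a'], (sqcl_repr c), c0; apply/(isometric_congruent F2).
  exact: congruent_refl.
- exact: diag_of_qscale.
move=> A h; have -> : form_sum h (map ( *%R (sqcl_repr c)) r3) = form_sum (fun v => h (c + v)) r3.
  rewrite /form_sum /wsum !big_map big_seq [RHS]big_seq; apply: eq_bigr => x xr.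
  have x0 : x != 0 := allP (diag_of_all_neq0 p3) x xr.
  by rewrite sqclM // sqcl_reprK.
rewrite J3 !J2 !J1 !form_sum_cons !form_sum_nil !addr0 /wsum /flat !big_cons big_nil addr0 /=.
move: (sqcl (- sval a')) (sqcl (- sval b')) (sqcl (- sval d')) => x y z.
have E1 (u v : sqclass F) : c + (v + u) = c + u + v by rewrite addrA addrAC.
have E2 : c + (z + (y + x)) = c + x + y + z by char2 (@sqclass2 F).
by rewrite E2 !E1 !addrA.
Qed.


Lemma form_sum_opp (A : zmodType) (h : sqclass F -> A) (s : seq F) : all_neq0 s -> witt_fun h ->
  form_sum h (map -%R s) = - form_sum h s.
Proof.
move=> nzs hh; elim: s nzs => [|a s IH] /=; first by rewrite !form_sum_nil oppr0.
by case/andP=> a0 /IH E; rewrite !form_sum_cons E sqclN // hh.1 opprD.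
Qed.

Lemma all_neq0_opp (s : seq F) : all_neq0 (map -%R s) = all_neq0 s.
Proof. by rewrite /all_neq0 all_map; apply: eq_all => a; rewrite /= oppr_eq0. Qed.

(** Both s + (-t) and (-t) + t are hyperbolic, and s + (-t) + t equals s up to the
    second and t up to the first. *)
Lemma witt_eq_of_form_sum q p s t : diag_of q s -> diag_of p t ->
  (forall (A : zmodType) (h : sqclass F -> A), witt_fun h -> form_sum h s = form_sum h t) ->
  witt_eq q p.
Proof.
move=> qs pt E; have nzs := diag_of_all_neq0 qs; have nzt := diag_of_all_neq0 pt.
have [|A h hh|m Hm] := @witt_zero_hyperbolic _ F2 (s ++ map -%R t).
- by rewrite /all_neq0 all_cat; apply/andP; split=> //; rewrite -/(all_neq0 _) all_neq0_opp.
- by rewrite form_sum_cat form_sum_opp // (E _ _ hh) addrN.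
have [|A h hh|n Hn] := @witt_zero_hyperbolic _ F2 (map -%R t ++ t).
- by rewrite /all_neq0 all_cat; apply/andP; split=> //; rewrite -/(all_neq0 _) all_neq0_opp.
- by rewrite form_sum_cat form_sum_opp // addNr.
exists n, m; apply/(isometric_congruent F2).
have d1 := diag_of_qsum qs (diag_of_hyperbolic F n).
have d2 := diag_of_qsum pt (diag_of_hyperbolic F m).
apply: congruent_trans d1 (congruent_trans _ (congruent_sym d2)).
apply: diag_iso_trans (diag_iso_cat (diag_iso_refl s) (diag_iso_sym Hn)) _; rewrite catA.
apply: diag_iso_trans (diag_iso_cat Hm (diag_iso_refl t)) _.
by apply: diag_iso_perm; rewrite perm_catC.
Qed.

End Final.

Theorem proposition5p3 (F : fieldType) (char_neq2 : 2%N \notin [pchar F])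
    (F_rigid : rigid F) (phi : qform F) (phi_anisotropic : anisotropic phi)
    (phi_dim : qdim phi = 14%N) (phi_I3 : fund_ideal3 phi) :
  exists pi1 pi2 : qform F,
    [/\ GP 3 pi1, GP 3 pi2 & witt_eq phi (qsum pi1 pi2)].
Proof.
have F2 : (2 : F) != 0 by move: char_neq2; rewrite inE.
have [s phis] := ex_diag F2 phi; have nzs := diag_of_all_neq0 phis.
have an : anisotropic_mx (diagm s) := congruent_anisotropic phis phi_anisotropic.
have s14 : size (map (@sqcl F) s) = 14%N by rewrite size_map (diag_of_size phis).
have [|fl v r|c [a [b [d [c' [a' [b' [d' E]]]]]]]] := two_flats (@sqclass2 F) s14
  (fund_ideal3_in_I3 F2 F_rigid phis phi_I3).
- by move=> v w r; apply: anisotropic_sqcl_pair.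
- exact: anisotropic_sqcl_triple.
have [pi1 [r1 [G1 p1 J1]]] := diag_of_GP3 F2 c a b d.
have [pi2 [r2 [G2 p2 J2]]] := diag_of_GP3 F2 c' a' b' d'.
exists pi1, pi2; split=> //.
apply: (witt_eq_of_form_sum F2 phis (diag_of_qsum p1 p2)) => A h hh.
by rewrite form_sum_cat J1 J2; apply: E.
Qed.
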